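(* Let $(X,\mathcal{B},\mu)$ be a probability space and let $T_1,\dots,T_k$ be measurable transformations of $(X,\mathcal{B})$ such that for each $i$ there is a $T_i$-invariant probability measure $\mu_i$ equivalent to $\mu$. The following conditions are equivalent: (i) $T_1,\dots,T_k$ are uniformly jointly ergodic with respect to $(\mu;\mu_1,\dots,\mu_k)$, i.e. for all bounded measurable $f_1,\dots,f_k$, $\lim_{N-M\to\infty}\frac{1}{N-M}\sum_{n=M}^{N-1} T_1^nf_1\cdot T_2^nf_2\cdots T_k^nf_k=\prod_{i=1}^k\int f_i\,d\mu_i$ in $L^2(\mu)$; (ii) for all bounded measurable $f_0,f_1,\dots,f_k$, $\lim_{N-M\to\infty}\frac{1}{N-M}\sum_{n=M}^{N-1}\int f_0\cdot T_1^nf_1\cdots T_k^nf_k\,d\mu=\int f_0\,d\mu\cdot\prod_{i=1}^k\int f_i\,d\mu_i$; (iii) (a) $T_1\times\cdots\times T_k$ is ergodic with respect to $\mu_1\times\cdots\times\mu_k$, and (b) for all bounded measurable $f_1,\dots,f_k$, $\lim_{N-M\to\infty}\frac{1}{N-M}\sum_{n=M}^{N-1}\int T_1^nf_1\cdots T_k^nf_k\,d\mu=\prod_{i=1}^k\int f_i\,d\mu_i$; (iv) (a) $T_1\times\cdots\times T_k$ is ergodic with respect to $\mu_1\times\cdots\times\mu_k$, and (b) there is $C>0$ such that for all $A_1,\dots,A_k\in\mathcal{B}$, $\limsup_{N-M\to\infty}\frac{1}{N-M}\sum_{n=M}^{N-1}\mu(T_1^{-n}A_1\cap\cdots\cap T_k^{-n}A_k)\le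 C\prod_{i=1}^k\mu_i(A_i)$.
   Context: For a measurable map $T$ and a function $f$, $T^nf:=f\circ T^n$. A statement ''$\lim_{N-M\to\infty}a_{M,N}=a$'' (for $0\le M<N$ integers) means: for every $\varepsilon>0$ there is $L$ such that $|a_{M,N}-a|<\varepsilon$ (resp. the $L^2$ norm of the difference is $<\varepsilon$) whenever $N-M\ge L$; $\limsup_{N-M\to\infty}$ is understood analogously. The probability space is assumed to be a compact metric space with its Borel $\sigma$-algebra. *)

(* Defs.v *)
From HB Require Import structures.
From mathcomp Require Import all_boot all_order all_algebra.
From mathcomp Require Import all_classical all_reals all_analysis.
Set Implicit Arguments. Unset Strict Implicit. Unset Printing Implicit Defensive.
Import Order.TTheory GRing.Theory Num.Theory.
Local Open Scope classical_set_scope.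
Local Open Scope ring_scope.

Section Defs.
Context {R : realType} {d : measure_display} {X : measurableType d}.

(** ** Standing assumption: X is a compact metric space with its Borel sigma-algebra,
    expressed through an explicit distance [dist] on the carrier of X. *)
Definition is_metric (dist : X -> X -> R) : Prop :=
  [/\ forall x y, 0 <= dist x y,
      forall x y, dist x y = 0 <-> x = y,
      forall x y, dist x y = dist y x &
      forall x y z, dist x z <= dist x y + dist y z].

Definition dball (dist : X -> X -> R) (x : X) (r : R) : set X :=
  [set y | dist x y < r].

Definition dopen (dist : X -> X -> R) (U : set X) : Prop :=
  forall x, U x -> exists r, 0 < r /\ dball dist x r `<=` U.

Definition dcompact (dist : X -> X -> R) : Prop :=
  forall (I : Type) (U : I -> set X), (forall i, dopen dist (U i)) ->
    \bigcup_i U i = setT ->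
    exists F : set I, finite_set F /\ \bigcup_(i in F) U i = setT.

Definition compact_metric_borel (dist : X -> X -> R) : Prop :=
  [/\ is_metric dist, dcompact dist &
      forall A : set X, measurable A <-> <<s dopen dist >> A].

Definition bdd_meas (f : X -> R) : Prop :=
  measurable_fun setT f /\ exists M : R, forall x, `|f x| <= M.

Definition invariant_measure (T : X -> X) (nu : {measure set X -> \bar R}) : Prop :=
  forall A, measurable A -> nu (T @^-1` A) = nu A.

Definition equiv_measure (nu1 nu2 : {measure set X -> \bar R}) : Prop :=
  forall A, measurable A -> (nu1 A = 0%E <-> nu2 A = 0%E).

Definition cvg_diff (a : nat -> nat -> R) (l : R) : Prop :=
  forall e : R, 0 < e -> exists L : nat, forall M N : nat,
    (M < N)%N -> (L <= N - M)%N -> `|a M N - l| < e.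

Definition L2cvg_diff (mu : {measure set X -> \bar R})
    (g : nat -> nat -> X -> R) (c : R) : Prop :=
  forall e : R, 0 < e -> exists L : nat, forall M N : nat,
    (M < N)%N -> (L <= N - M)%N ->
    (Lnorm mu 2%:E (fun x => (g M N x - c)%:E) < e%:E)%E.

Definition limsup_diff (a : nat -> nat -> \bar R) : \bar R :=
  ereal_inf (range (fun L : nat =>
    ereal_sup [set a MN.1 MN.2 | MN in
               [set MN : nat * nat | (MN.1 < MN.2)%N /\ (L <= MN.2 - MN.1)%N]])).

End Defs.

Section Product.
Context {R : realType} {d : measure_display} {X : measurableType d} {k : nat}.

Definition tuple_map (T : 'I_k -> X -> X) (x : k.-tuple X) : k.-tuple X :=
  [tuple T i (tnth x i) | i < k].

(** nu is the product measure mu_1 x ... x mu_k (determined by its values on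
    measurable rectangles) *)
Definition is_product_measure (mu_ : 'I_k -> {measure set X -> \bar R})
    (nu : {measure set (k.-tuple X) -> \bar R}) : Prop :=
  forall A : 'I_k -> set X, (forall i, measurable (A i)) ->
    nu [set x | forall i, A i (tnth x i)] = (\prod_(i < k) fine (mu_ i (A i)))%:E.

Definition ergodic_wrt {Y : measurableType (measure_tuple_display d)}
    (nu : {measure set Y -> \bar R}) (S : Y -> Y) : Prop :=
  forall B, measurable B -> S @^-1` B = B -> nu B = 0%E \/ nu B = 1%E.

Definition product_ergodic (T : 'I_k -> X -> X)
    (mu_ : 'I_k -> {measure set X -> \bar R}) : Prop :=
  forall nu : {measure set (k.-tuple X) -> \bar R},
    is_product_measure mu_ nu -> ergodic_wrt nu (tuple_map T).

End Product.

(* Main.v *)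
(* The only substantial implications are (ii) => (iii)(a) and (iv) => (i).

   (ii) => ergodicity.  Let S = T_1 x ... x T_k and let F be bounded, strictly
   S-invariant and a uniform limit of sums of product functions.  On the diagonal
   F is its own ergodic average, so (ii) gives F(x,...,x) = int F a.e.; the same
   for F^2 shows that F has zero variance.  A general invariant K with int K = 0
   is made into such an F by smoothing one coordinate after the other: K is
   replaced by P_j K(x) = int Phi(x_j, w) K(x with x_j := w) dmu_j(w), where
   Phi(s, t) = int K(v with v_j := s) K(v with v_j := t) is T_j x T_j-invariant.
   Each step turns L1 approximation in the j-th coordinate into uniform
   approximation, and loses nothing: int K * P_j K is the integral of Phi^2, and
   Phi = 0 forces K = 0.

   (iv) => (i).  Up to O(m/(N-M)), averages of H(S^n(x,...,x)), with H a product
   function, are averages of (A_m H)(S^n(x,...,x)), where A_m H is an ergodic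
   average for S.  Domination bounds the L2(mu) distance of these to int H by
   C times the L2 distance of A_m H to int H, which is small by the mean ergodic
   theorem. *)
Require Import Defs.
From HB Require Import structures.
From mathcomp Require Import all_boot all_order all_algebra.
From mathcomp Require Import all_classical all_reals all_analysis.
From mathcomp Require Import measurable_realfun.
From mathcomp Require Import ring lra.
Import Order.TTheory GRing.Theory Num.Theory.
Local Open Scope classical_set_scope.
Local Open Scope ring_scope.
Set Implicit Arguments.
Unset Strict Implicit.
Unset Printing Implicit Defensive.

(** * Integration of bounded measurable functions *)

(** Hypotheses (ii) and (iv) speak of orbits issued from the diagonal, which the product measure may
    not charge. A function known only up to a null set, or approximated only in L1, tells nothing
    there; hence invariance is taken strictly and approximation has to be uniform before (ii) can be
    used. The smoothing comes from reading K as the kernel of an operator A from functions of x_j to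
    functions of the other coordinates. With A' its adjoint, Phi is the kernel of A' A and P_j K
    that of A A' A, so that the vanishing of P_j K gives A' A = 0 and then A = 0. The zero mean has
    to survive each step too; this is obtained from (ii) again, applied to an invariant function of
    one coordinate. In (iv) only a one-sided bound on rectangles is given, so it extends only to
    non-negative combinations of their indicators. The square of A_m H - int H becomes one as soon
    as the factors of H take finitely many values, since it then depends only on the itineraries of
    the coordinates. *)

Section BoundedMeasurable.
Context {R : realType} {d : measure_display} {T : measurableType d}.
Implicit Types f g : T -> R.

Lemma bdd_meas_cst (c : R) : bdd_meas (fun _ : T => c).
Proof. by split; [exact: measurable_cst|exists `|c|]. Qed.

Lemma bdd_measD f g : bdd_meas f -> bdd_meas g ->
  bdd_meas (fun x => f x + g x).
Proof.
move=> [mf [M fM]] [mg [N gN]]; split; first exact: measurable_funD.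
by exists (M + N) => x; rewrite (le_trans (ler_normD _ _))// lerD.
Qed.

Lemma bdd_measM f g : bdd_meas f -> bdd_meas g ->
  bdd_meas (fun x => f x * g x).
Proof.
move=> [mf [M fM]] [mg [N gN]]; split; first exact: measurable_funM.
by exists (M * N) => x; rewrite normrM ler_pM.
Qed.

Lemma bdd_measZ (c : R) f : bdd_meas f -> bdd_meas (fun x => c * f x).
Proof. by move=> bf; apply: bdd_measM => //; exact: bdd_meas_cst. Qed.

Lemma bdd_measB f g : bdd_meas f -> bdd_meas g ->
  bdd_meas (fun x => f x - g x).
Proof.
move=> bf bg; under eq_fun do rewrite -mulN1r.
by apply: bdd_measD => //; exact: bdd_measZ.
Qed.

Lemma bdd_measX n f : bdd_meas f -> bdd_meas (fun x => f x ^+ n).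
Proof.
move=> bf; elim: n => [|n ih].
  by under eq_fun do rewrite expr0; exact: bdd_meas_cst.
by under eq_fun do rewrite exprS; exact: bdd_measM.
Qed.

Lemma bdd_meas_norm f : bdd_meas f -> bdd_meas (fun x => `|f x|).
Proof.
move=> [mf [M fM]]; split; first exact: measurableT_comp.
by exists M => x; rewrite normr_id.
Qed.

Lemma bdd_meas_sum (I : Type) (r : seq I) (F : I -> T -> R) :
  (forall i, bdd_meas (F i)) -> bdd_meas (fun x => \sum_(i <- r) F i x).
Proof.
move=> bF; elim: r => [|i r ih].
  by under eq_fun do rewrite big_nil; exact: bdd_meas_cst.
by under eq_fun do rewrite big_cons; exact: bdd_measD.
Qed.

Lemma bdd_meas_prod (I : Type) (r : seq I) (P : pred I) (F : I -> T -> R) :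
  (forall i, bdd_meas (F i)) -> bdd_meas (fun x => \prod_(i <- r | P i) F i x).
Proof.
move=> bF; elim: r => [|i r ih].
  by under eq_fun do rewrite big_nil; exact: bdd_meas_cst.
by under eq_fun do rewrite big_cons; case: (P i) => //; exact: bdd_measM.
Qed.

Lemma bdd_meas_indic (A : set T) : measurable A -> bdd_meas (\1_A : T -> R).
Proof.
move=> mA; split; first exact: measurable_indic.
by exists 1 => x; rewrite indicE; case: (_ \in _); rewrite ?normr1 ?normr0.
Qed.

Lemma bdd_meas_comp d' (T' : measurableType d') (f : T -> R) (h : T' -> T) :
  bdd_meas f -> measurable_fun setT h -> bdd_meas (fun x => f (h x)).
Proof.
by move=> [mf [M fM]] mh; split; [exact: measurableT_comp|exists M => x].
Qed.

Lemma bdd_meas_bound f : bdd_meas f -> exists2 M, 0 < M & forall x, `|f x| <= M.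
Proof.
move=> [_ [M fM]]; exists (`|M| + 1); first by rewrite ltr_pwDr.
by move=> x; rewrite (le_trans (fM x))// (le_trans (ler_norm _))// lerDl.
Qed.

Lemma measurable_iter (h : T -> T) n :
  measurable_fun setT h -> measurable_fun setT (iter n h).
Proof.
by move=> mh; elim: n => [|n ih]; [exact: measurable_id|exact: (measurableT_comp mh)].
Qed.

End BoundedMeasurable.

(** * Real-valued expectation of bounded functions *)

Section Expectation.
Context {R : realType} {d : measure_display} {T : measurableType d}.
Variable P : probability T R.
Implicit Types f g : T -> R.

Lemma bdd_meas_integrable f : bdd_meas f -> P.-integrable setT (EFin \o f).
Proof.
move=> [mf [M fM]]; apply: (@le_integrable _ _ _ _ _ _ _ (cst M%:E)) => //.
- exact/measurable_EFinP.
- by move=> x _ /=; rewrite lee_fin (le_trans (fM x))// ler_norm.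
- exact: finite_measure_integrable_cst.
Qed.

Lemma EFin_Rint f : bdd_meas f ->
  (\int[P]_x f x)%:E = (\int[P]_x (f x)%:E)%E.
Proof.
move=> bf; rewrite /Rintegral fineK//.
exact: integrable_fin_num (bdd_meas_integrable bf).
Qed.

Lemma RintD f g : bdd_meas f -> bdd_meas g ->
  \int[P]_x (f x + g x) = \int[P]_x f x + \int[P]_x g x.
Proof. by move=> bf bg; rewrite RintegralD//; exact: bdd_meas_integrable. Qed.

Lemma RintB f g : bdd_meas f -> bdd_meas g ->
  \int[P]_x (f x - g x) = \int[P]_x f x - \int[P]_x g x.
Proof. by move=> bf bg; rewrite RintegralB//; exact: bdd_meas_integrable. Qed.

Lemma RintZ (c : R) f : bdd_meas f -> \int[P]_x (c * f x) = c * \int[P]_x f x.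
Proof. by move=> bf; rewrite RintegralZl//; exact: bdd_meas_integrable. Qed.

Lemma Rint_cst (c : R) : \int[P]_x c = c.
Proof.
rewrite Rintegral_cst// -[RHS]mulr1; congr (_ * _).
by have /(congr1 fine) := probability_setT P.
Qed.

Lemma Rint_sum (I : Type) (r : seq I) (F : I -> T -> R) :
  (forall i, bdd_meas (F i)) ->
  \int[P]_x (\sum_(i <- r) F i x) = \sum_(i <- r) \int[P]_x F i x.
Proof.
move=> bF; elim: r => [|i r ih].
  by under eq_Rintegral do rewrite big_nil; rewrite Rint_cst big_nil.
under eq_Rintegral do rewrite big_cons.
by rewrite RintD ?ih ?big_cons//; exact: bdd_meas_sum.
Qed.

Lemma ge0_Rint f : (forall x, 0 <= f x) -> 0 <= \int[P]_x f x.
Proof. by move=> f0; exact: Rintegral_ge0. Qed.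

Lemma le_Rint f g : bdd_meas f -> bdd_meas g -> (forall x, f x <= g x) ->
  \int[P]_x f x <= \int[P]_x g x.
Proof. by move=> bf bg fg; apply: le_Rintegral => //; exact: bdd_meas_integrable. Qed.

Lemma norm_Rint f : bdd_meas f -> `|\int[P]_x f x| <= \int[P]_x `|f x|.
Proof. by move=> bf; apply: le_normr_Rintegral => //; exact: bdd_meas_integrable. Qed.

Lemma norm_Rint_le f (M : R) : bdd_meas f -> (forall x, `|f x| <= M) ->
  `|\int[P]_x f x| <= M.
Proof.
move=> bf fM; apply: le_trans (norm_Rint bf) _.
rewrite -[leRHS]Rint_cst; apply: le_Rint => //.
- exact: bdd_meas_norm.
- exact: bdd_meas_cst.
Qed.

Lemma Rint_indic (A : set T) : measurable A -> \int[P]_x \1_A x = fine (P A).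
Proof. by move=> mA; rewrite /Rintegral integral_indic// setIT. Qed.

(* AM-GM with a free parameter *)
Lemma Rint_null_mul f g : bdd_meas f -> bdd_meas g ->
  \int[P]_x f x ^+ 2 = 0 -> \int[P]_x (f x * g x) = 0.
Proof.
move=> bf bg f0; apply/eqP; rewrite -normr_le0 leNgt; apply/negP => e0.
have [M M0 gM] := bdd_meas_bound bg.
set e := `|_| in e0 *.
(* With this t the constant term M^2 / (2 t) is e / 2, while the other term integrates to 0; so e <=
   e / 2. *)
pose t := M ^+ 2 / e.
have t0 : 0 < t by rewrite divr_gt0// exprn_gt0.
have : e <= \int[P]_x ((t / 2) * f x ^+ 2 + M ^+ 2 / (2 * t)).
  apply: le_trans (norm_Rint _) _; first exact: bdd_measM.
  apply: le_Rint.
  - by apply/bdd_meas_norm/bdd_measM.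
  - by apply: bdd_measD; [exact/bdd_measZ/bdd_measX|exact: bdd_meas_cst].
  - move=> x; rewrite normrM (@le_trans _ _ (`|f x| * M))//.
      by rewrite ler_wpM2l.
    rewrite -subr_ge0 -(real_normK (num_real (f x))).
    rewrite [leRHS](_ : _ = (t * `|f x| - M) ^+ 2 / (2 * t)).
      by rewrite divr_ge0 ?sqr_ge0// mulr_ge0 ?ltW.
    by field; rewrite gt_eqF.
have bf2 : bdd_meas (fun x => f x ^+ 2) by exact: bdd_measX.
rewrite RintD ?Rint_cst ?RintZ ?f0//; try exact: bdd_measZ; try exact: bdd_meas_cst.
rewrite mulr0 add0r (_ : _ / _ = e / 2); last first.
  by rewrite /t; field; rewrite !gt_eqF.
by rewrite leNgt; move/negP; apply; rewrite ltr_pdivrMr// ltr_pMr// ltr1n.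
Qed.

Lemma Rint_comp d' (T' : measurableType d') (Q : probability T' R)
    (h : T -> T') (F : T' -> R) :
  measurable_fun setT h -> (forall A, measurable A -> P (h @^-1` A) = Q A) ->
  bdd_meas F -> \int[P]_x F (h x) = \int[Q]_y F y.
Proof.
move=> mh hPQ bF; rewrite /Rintegral; congr fine.
have [mF _] := bF.
rewrite [RHS](eq_measure_integral (pushforward P h)); last first.
  by move=> A mA _; exact: esym (hPQ A mA).
rewrite integral_pushforward//=.
- exact/measurable_EFinP.
- rewrite preimage_setT; exact: bdd_meas_integrable (bdd_meas_comp bF mh).
Qed.

End Expectation.

(** * Fubini for bounded functions on a product of two probability spaces *)

Section FubiniBounded.
Context {R : realType} {d1 d2 : measure_display}.
Context {T1 : measurableType d1} {T2 : measurableType d2}.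
Variables (P1 : probability T1 R) (P2 : probability T2 R).

Let prodP := (P1 \x P2)%E.

HB.instance Definition _ := Measure.on prodP.

Let prodP_setT : prodP setT = 1%E.
Proof.
rewrite -setXTT [LHS]product_measure1E// -[RHS]mule1.
by congr (_ * _)%E; exact: probability_setT.
Qed.

HB.instance Definition _ := Measure_isProbability.Build _ _ _ prodP prodP_setT.

(** Bundled as a probability, so that the lemmas on expectations apply to it and it can be a factor
    of a further product. *)
Definition prob_prod : probability (T1 * T2)%type R := prodP.

Lemma prob_prodE (A : set T1) (B : set T2) : measurable A -> measurable B ->
  prob_prod (A `*` B) = (P1 A * P2 B)%E.
Proof. exact: product_measure1E. Qed.

Variable F : T1 * T2 -> R.
Hypothesis bF : bdd_meas F.

Let iF : (P1 \x P2)%E.-integrable setT (EFin \o F).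
Proof. exact: (bdd_meas_integrable prob_prod bF). Qed.

Lemma bdd_meas_pair1 x : bdd_meas (fun y => F (x, y)).
Proof. by apply: (bdd_meas_comp bF); exact: pair1_measurable. Qed.

Lemma bdd_meas_pair2 y : bdd_meas (fun x => F (x, y)).
Proof. by apply: (bdd_meas_comp bF); exact: pair2_measurable. Qed.

Lemma bdd_meas_Rint2 : bdd_meas (fun x => \int[P2]_y F (x, y)).
Proof.
have [M M0 FM] := bdd_meas_bound bF.
split; last first.
  by exists M => x; apply: norm_Rint_le => //; exact: bdd_meas_pair1.
apply/measurable_EFinP; apply: eq_measurable_fun (measurable_fubini_F iF) => x _.
by rewrite /= EFin_Rint//; exact: bdd_meas_pair1.
Qed.

Lemma bdd_meas_Rint1 : bdd_meas (fun y => \int[P1]_x F (x, y)).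
Proof.
have [M M0 FM] := bdd_meas_bound bF.
split; last first.
  by exists M => y; apply: norm_Rint_le => //; exact: bdd_meas_pair2.
apply/measurable_EFinP; apply: eq_measurable_fun (measurable_fubini_G iF) => y _.
by rewrite /= EFin_Rint//; exact: bdd_meas_pair2.
Qed.

Lemma Rint_prod12 : \int[prob_prod]_z F z = \int[P1]_x \int[P2]_y F (x, y).
Proof.
apply: EFin_inj; rewrite EFin_Rint// EFin_Rint; last exact: bdd_meas_Rint2.
rewrite -[LHS](integral12_prod_meas1 iF); apply: eq_integral => x _.
by rewrite EFin_Rint//; exact: bdd_meas_pair1.
Qed.

Lemma Rint_prod21 : \int[prob_prod]_z F z = \int[P2]_y \int[P1]_x F (x, y).
Proof.
apply: EFin_inj; rewrite EFin_Rint// EFin_Rint; last exact: bdd_meas_Rint1.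
rewrite -[LHS](integral21_prod_meas1 iF); apply: eq_integral => x _.
by rewrite EFin_Rint//; exact: bdd_meas_pair2.
Qed.

Lemma Rint_swap :
  \int[P1]_x \int[P2]_y F (x, y) = \int[P2]_y \int[P1]_x F (x, y).
Proof. by rewrite -Rint_prod12 Rint_prod21. Qed.

End FubiniBounded.

(** * Discretization *)

Section Discretization.
Context {R : realType}.

(** Telescoping: the factors are exchanged one at a time, the others being bounded by D. With
    [1 <= D], the power D^(size r) also bounds the shorter products. *)
Lemma norm_prodB (I : Type) (r : seq I) (a b : I -> R) (D e : R) :
  1 <= D -> 0 <= e -> (forall i, `|a i| <= D) -> (forall i, `|b i| <= D) ->
  (forall i, `|a i - b i| <= e) ->
  `|\prod_(i <- r) a i - \prod_(i <- r) b i| <= (size r)%:R * D ^+ size r * e.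
Proof.
move=> D1 e0 aD bD abe; have D0 : 0 <= D by apply: le_trans D1.
have pD (s : seq I) : `|\prod_(i <- s) a i| <= D ^+ size s.
  elim: s => [|i s ih]; first by rewrite big_nil normr1.
  by rewrite big_cons normrM exprS ler_pM.
elim: r => [|i r ih]; first by rewrite !big_nil subrr normr0 !mul0r.
rewrite !big_cons.
have -> : a i * \prod_(j <- r) a j - b i * \prod_(j <- r) b j =
    (a i - b i) * \prod_(j <- r) a j +
    b i * (\prod_(j <- r) a j - \prod_(j <- r) b j) by ring.
apply: le_trans (ler_normD _ _) _; rewrite !normrM /=.
have h1 : `|a i - b i| * `|\prod_(j <- r) a j| <= D ^+ (size r).+1 * e.
  rewrite mulrC ler_pM// (le_trans (pD r))// exprS ler_peMl// exprn_ge0//.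
have h2 : `|b i| * `|\prod_(j <- r) a j - \prod_(j <- r) b j| <=
    D * ((size r)%:R * D ^+ size r * e) by rewrite ler_pM.
apply: le_trans (lerD h1 h2) _.
rewrite le_eqVlt; apply/orP; left; apply/eqP.
by rewrite -natr1 exprS; ring.
Qed.

Lemma prod_unif_cont (I : finType) (M e : R) : 0 < M -> 0 < e ->
  exists2 del, 0 < del & forall a b : I -> R, (forall i, `|a i| <= M) ->
    (forall i, `|a i - b i| <= del) -> `|\prod_i a i - \prod_i b i| <= e.
Proof.
(* Only [a] is assumed bounded by M; a radius at most 1 keeps [b] below M + 1. *)
move=> M0 e0; pose D := M + 1.
have D1 : 1 <= D by rewrite lerDr ltW.
pose s := size (index_enum I).
pose K : R := s%:R * D ^+ s.
have K0 : 0 <= K by rewrite mulr_ge0// exprn_ge0// (le_trans _ D1).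
have K1 : 0 < K + 1 by rewrite ltr_wpDl.
exists (Num.min 1 (e / (K + 1))); first by rewrite lt_min ltr01 divr_gt0.
move=> a b aM ab.
have bD i : `|b i| <= D.
  have -> : b i = a i - (a i - b i) by ring.
  rewrite (le_trans (ler_normB _ _))// lerD// (le_trans (ab i))//.
  by rewrite ge_min lexx.
have aD i : `|a i| <= D by rewrite (le_trans (aM i))// lerDl.
have abe i : `|a i - b i| <= e / (K + 1).
  by rewrite (le_trans (ab i))// ge_min lexx orbT.
have ek : 0 <= e / (K + 1) by rewrite ltW// divr_gt0.
apply: le_trans (norm_prodB (index_enum I) D1 ek aD bD abe) _.
rewrite -/s -/K mulrCA ler_piMr// ?(ltW e0)//.
by rewrite ler_pdivrMr// mul1r lerDl.
Qed.

Context {d : measure_display} {T : measurableType d}.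

Lemma common_bound (I : finType) (f : I -> T -> R) :
  (forall i, bdd_meas (f i)) -> exists2 M, 0 < M & forall i x, `|f i x| <= M.
Proof.
move=> bf.
have /boolp.choice[M fM] : forall i, exists M, 0 < M /\ forall x, `|f i x| <= M.
  by move=> i; have [M M0 fM] := bdd_meas_bound (bf i); exists M.
exists (1 + \sum_i M i).
  by rewrite ltr_pwDl// sumr_ge0// => i _; rewrite ltW//; have [] := fM i.
move=> i x; have [_ /(_ x)/le_trans] := fM i; apply.
rewrite (bigD1 i)//= addrCA lerDl addr_ge0// sumr_ge0// => j _.
by rewrite ltW//; have [] := fM j.
Qed.

(** Values are encoded by labels in one finite type common to all [f i]: products of sums then
    expand over words of labels, and labels can be recorded along an orbit. *)
Lemma discretize (I : finType) (f : I -> T -> R) (e : R) :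
  (forall i, bdd_meas (f i)) -> 0 < e ->
  exists (r : nat) (phi : 'I_r.+1 -> R) (q : I -> T -> 'I_r.+1),
    (forall i a, measurable (q i @^-1` [set a])) /\
    forall i x, `|f i x - phi (q i x)| <= e.
Proof.
move=> bf e0; have [M M0 fM] := common_bound bf.
(* This lies between 0 and 2 M / e; its integer part is the label, and the label a stands for the
   value a e - M. *)
pose u i x := (f i x + M) / e.
have u0 i x : 0 <= u i x.
  have := fM i x; rewrite ler_norml => /andP[h _].
  by apply: divr_ge0; [move: h; lra|exact: ltW].
have uM i x : u i x <= (2 * M) / e.
  rewrite ler_wpM2r ?invr_ge0 ?(ltW e0)//.
  by have := fM i x; rewrite ler_norml => /andP[]; lra.
pose r := Num.truncn ((2 * M) / e).
have ur i x : (Num.truncn (u i x) < r.+1)%N by rewrite ltnS le_truncn.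
exists r, (fun a => (a : nat)%:R * e - M), (fun i x => inord (Num.truncn (u i x))).
split=> [i a|i x]; last first.
  rewrite inordK//; have /truncn_itv/andP[h1 h2] := u0 i x.
  move: h1 h2; rewrite -(ler_pM2r e0) -(ltr_pM2r e0) /u mulfVK ?gt_eqF//.
  by rewrite -natr1 ler_norml => h1 h2; apply/andP; split; lra.
have mu : measurable_fun setT (u i).
  apply: measurable_funM => //; apply: measurable_funD => //.
  by have [] := bf i.
have := mu measurableT `[(a : nat)%:R, (a : nat).+1%:R[%classic (measurable_itv _).
rewrite setTI; congr measurable; apply/seteqP; split=> x /=.
- rewrite in_itv /= => ax; apply/val_inj; rewrite /= inordK//.
  exact/truncn_def.
- by move=> <-; rewrite inordK// in_itv /=; exact: truncn_itv.
Qed.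

Lemma discretize_sum (r : nat) (phi : 'I_r.+1 -> R) (q : T -> 'I_r.+1) x :
  phi (q x) = \sum_a phi a * \1_(q @^-1` [set a]) x.
Proof.
rewrite (bigD1 (q x)) //= big1 ?addr0; last first.
  by move=> a aq; rewrite indicE memNset ?mulr0//= => qx; rewrite qx eqxx in aq.
by rewrite indicE mem_set// mulr1.
Qed.

End Discretization.

(** * Product measures on tuples *)

Section Rectangles.
Context {d : measure_display} {X : measurableType d} {k : nat}.

Definition rect (A : 'I_k -> set X) : set (k.-tuple X) :=
  [set x | forall i, A i (tnth x i)].

Lemma measurable_rect (A : 'I_k -> set X) :
  (forall i, measurable (A i)) -> measurable (rect A).
Proof.
move=> mA.
have -> : rect A = \bigcap_(i in setT) ((fun x => tnth x i) @^-1` A i).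
  by apply/seteqP; split=> x /= h; [move=> i _|move=> i]; exact: h.
apply: fin_bigcap_measurable => [|i _]; first exact: finite_finset.
by have := measurable_tnth i measurableT (mA i); rewrite setTI.
Qed.

Definition mrects : set (set (k.-tuple X)) :=
  [set rect A | A in [set A | forall i, measurable (A i)]].

Lemma indic_rect {R : realType} (A : 'I_k -> set X) x :
  \1_(rect A) x = \prod_(i < k) \1_(A i) (tnth x i) :> R.
Proof.
rewrite indicE; case: (boolP (x \in rect A)).
  move=> /set_mem Ax; apply/esym/big1 => i _.
  by rewrite indicE mem_set//; exact: Ax.
move=> /negP xA; have /existsNP[i Ai] : ~ (forall i, A i (tnth x i)).
  by move=> h; apply: xA; exact: mem_set.
by rewrite (bigD1 i)//= indicE memNset// mul0r.
Qed.

Lemma mrects_setI : setI_closed mrects.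
Proof.
move=> _ _ [A mA <-] [B mB <-]; exists (fun i => A i `&` B i).
  by move=> i; exact: measurableI.
apply/seteqP; split=> x /= h; first by split=> i; have [] := h i.
by move=> i; split; [exact: h.1|exact: h.2].
Qed.

(** The sigma-algebra on tuples is generated by preimages under single coordinates, which are
    rectangles with all other sides equal to the whole space. *)
Lemma measurable_mrects : measurable = <<s mrects >>.
Proof.
apply/seteqP; split=> B; last first.
  apply: smallest_sub; first exact: sigma_algebra_measurable.
  by move=> _ [A mA <-]; exact: measurable_rect.
apply: smallest_sub; first exact: smallest_sigma_algebra.
move=> C; rewrite /= -bigcup_seq/= => -[i _ [A mA <-]].
apply: sub_sigma_algebra; exists (fun j => if j == i then A else setT).
  by move=> j; case: eqP.
rewrite setTI; apply/seteqP; split=> x /=.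
  by move=> /(_ i); rewrite eqxx.
by move=> Ax j; case: eqP => // ->.
Qed.

Lemma mrects_dynkin (H : set (set (k.-tuple X))) :
  dynkin H -> mrects `<=` H -> measurable `<=` H.
Proof.
move=> dH rH B; rewrite measurable_mrects.
rewrite -(setI_closed_g_dynkin_g_sigma_algebra mrects_setI).
by apply: smallest_sub.
Qed.

Lemma measurable_tuple_map (T : 'I_k -> X -> X) :
  (forall i, measurable_fun setT (T i)) -> measurable_fun setT (tuple_map T).
Proof.
move=> mT; apply/measurable_fun_tnthP => i.
rewrite (_ : _ \o _ = fun x => T i (tnth x i)); last first.
  by apply/funext => x /=; rewrite tnth_mktuple.
by apply: measurableT_comp => //; exact: measurable_tnth.
Qed.

Definition upd (i : 'I_k) (x : k.-tuple X) (s : X) : k.-tuple X :=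
  [tuple if j == i then s else tnth x j | j < k].

Lemma tnth_upd i x s j : tnth (upd i x s) j = if j == i then s else tnth x j.
Proof. by rewrite tnth_mktuple. Qed.

Lemma upd_upd i x s t : upd i (upd i x s) t = upd i x t.
Proof. by apply: eq_from_tnth => j; rewrite !tnth_upd; case: eqP. Qed.

Lemma tuple_map_upd (T : 'I_k -> X -> X) i x s :
  tuple_map T (upd i x s) = upd i (tuple_map T x) (T i s).
Proof.
apply: eq_from_tnth => j; rewrite tnth_upd !tnth_mktuple.
by case: eqP => // ->.
Qed.

Lemma measurable_upd d' (Z : measurableType d') i
    (g : Z -> k.-tuple X) (h : Z -> X) :
  measurable_fun setT g -> measurable_fun setT h ->
  measurable_fun setT (fun z => upd i (g z) (h z)).
Proof.
move=> mg mh; apply/measurable_fun_tnthP => j.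
rewrite (_ : _ \o _ = fun z => if j == i then h z else tnth (g z) j); last first.
  by apply/funext => x /=; rewrite tnth_upd.
case: eqP => _ //.
by apply: (measurableT_comp (measurable_tnth j)).
Qed.

End Rectangles.

(** * Integration against a product measure *)

Section ProductMeasure.
Context {R : realType} {d : measure_display} {X : measurableType d} {k : nat}.
Variables (mu_ : 'I_k -> probability X R).
Variable nu : probability (k.-tuple X) R.
Hypothesis hnu : is_product_measure (fun i => mu_ i) nu.

(** Rectangles form a pi-system. Applied to an image measure, this shows that a map has law [nu] by
    testing rectangles only. *)
Lemma product_measure_uniq (nu' : {measure set (k.-tuple X) -> \bar R}) :
  is_product_measure (fun i => mu_ i) nu' ->
  forall B, measurable B -> nu' B = nu B.
Proof.
move=> hnu' B mB; apply: (measure_unique mrects (fun _ => setT)) => //.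
- exact: measurable_mrects.
- exact: mrects_setI.
- move=> _; exists (fun _ => setT); first by move=> i; exact: measurableT.
  by apply/seteqP; split.
- by rewrite bigcup_const//; exists 0%N.
- by move=> _ [A mA <-]; rewrite [LHS]hnu'// [RHS]hnu.
- move=> _; have -> : [set: k.-tuple X] = rect (fun _ => setT).
    by apply/seteqP; split.
  by rewrite [ltLHS]hnu' ?ltry// => i; exact: measurableT.
Qed.

(* resampling the coordinate [i] *)
Lemma Rint_upd i (F : k.-tuple X -> R) : bdd_meas F ->
  \int[nu]_x \int[nu]_w F (upd i x (tnth w i)) = \int[nu]_y F y.
Proof.
move=> bF.
have mu2 : measurable_fun setT
    (fun z : k.-tuple X * k.-tuple X => upd i z.1 (tnth z.2 i)).
  apply: measurable_upd => //.
  by apply: (measurableT_comp (measurable_tnth i)).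
have bF2 : bdd_meas (fun z : k.-tuple X * k.-tuple X => F (upd i z.1 (tnth z.2 i))).
  exact: bdd_meas_comp bF mu2.
rewrite -(Rint_prod12 nu nu bF2).
apply: (Rint_comp mu2 _ bF).
apply: (@product_measure_uniq (pushforward (prob_prod nu nu) _)) => //.
move=> A mA; rewrite /pushforward.
(* The preimage of a rectangle tests coordinate i on w and all others on x, so it is a product of
   two rectangles. *)
pose A1 j := if j == i then setT else A j.
pose A2 j := if j == i then A i else setT.
have mA1 j : measurable (A1 j) by rewrite /A1; case: eqP.
have mA2 j : measurable (A2 j) by rewrite /A2; case: eqP.
transitivity (prob_prod nu nu (rect A1 `*` rect A2)).
  congr (prob_prod nu nu _); apply/seteqP; split=> -[x w] /=.
    move=> h; split=> j; rewrite /A1 /A2; have := h j; rewrite tnth_upd.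
      by case: eqP.
    by case: eqP => // ->.
  move=> [h1 h2] j; rewrite tnth_upd; case: eqP => [->|/eqP ji].
    by have := h2 i; rewrite /A2 eqxx.
  by have := h1 j; rewrite /A1 (negPf ji).
rewrite prob_prodE; [|exact: measurable_rect..].
rewrite [X in (X * _)%E]hnu// [X in (_ * X)%E]hnu// -EFinM; congr EFin.
rewrite -big_split /=; apply: eq_bigr => j _; rewrite /A1 /A2.
case: eqP => [->|_].
  by rewrite probability_setT mul1r.
by rewrite probability_setT mulr1.
Qed.

Lemma tuple_map_invariant (T : 'I_k -> X -> X) :
  (forall i, measurable_fun setT (T i)) ->
  (forall i, invariant_measure (T i) (mu_ i)) ->
  forall B, measurable B -> nu (tuple_map T @^-1` B) = nu B.
Proof.
move=> mT iT; have mS := measurable_tuple_map mT.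
apply: (@product_measure_uniq (pushforward nu _)) => //.
move=> A mA; rewrite /pushforward.
transitivity (nu (rect (fun i => T i @^-1` A i))).
  congr (nu _).
  by apply/seteqP; split=> x /= h j; have := h j; rewrite tnth_mktuple.
rewrite [LHS]hnu; last first.
  by move=> i; have := mT i measurableT _ (mA i); rewrite setTI.
by congr EFin; apply: eq_bigr => i _; rewrite [X in fine X]iT.
Qed.

Lemma Rint_tuple_map (T : 'I_k -> X -> X) (F : k.-tuple X -> R) :
  (forall i, measurable_fun setT (T i)) ->
  (forall i, invariant_measure (T i) (mu_ i)) ->
  bdd_meas F -> \int[nu]_x F (tuple_map T x) = \int[nu]_x F x.
Proof.
move=> mT iT bF.
exact: (Rint_comp (measurable_tuple_map mT) (tuple_map_invariant mT iT) bF).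
Qed.

Lemma Rint_prod_indic (A : 'I_k -> set X) : (forall i, measurable (A i)) ->
  \int[nu]_x \prod_(i < k) \1_(A i) (tnth x i) = \prod_(i < k) fine (mu_ i (A i)).
Proof.
move=> mA; under eq_Rintegral do rewrite -indic_rect.
by rewrite Rint_indic; [rewrite [X in fine X]hnu|exact: measurable_rect].
Qed.

Lemma bdd_meas_prod_tnth (f : 'I_k -> X -> R) : (forall i, bdd_meas (f i)) ->
  bdd_meas (fun x : k.-tuple X => \prod_(i < k) f i (tnth x i)).
Proof.
move=> bf; apply: bdd_meas_prod => i; apply: (bdd_meas_comp (bf i)).
exact: measurable_tnth.
Qed.

(** For functions with finitely many values both sides expand by distributivity to the same sum over
    words of labels; uniform approximation does the rest. *)
Lemma Rint_prod_tnth (f : 'I_k -> X -> R) : (forall i, bdd_meas (f i)) ->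
  \int[nu]_x \prod_(i < k) f i (tnth x i) = \prod_(i < k) \int[mu_ i]_x f i x.
Proof.
move=> bf; have [M M0 fM] := common_bound bf.
apply/eqP; rewrite -subr_eq0 -normr_le0; apply/ler_addgt0Pr => e e0.
rewrite add0r.
have e20 : 0 < e / 2 by rewrite divr_gt0.
have [del del0 hdel] := prod_unif_cont 'I_k M0 e20.
have [r [phi [q [mq fq]]]] := discretize bf del0.
pose g i x := phi (q i x).
have bg i : bdd_meas (g i).
  rewrite (_ : g i = fun x => \sum_a phi a * \1_(q i @^-1` [set a]) x).
    by apply: bdd_meas_sum => a; apply/bdd_measZ/bdd_meas_indic.
  by apply/funext => x; exact: discretize_sum.
have Eg : \int[nu]_x \prod_(i < k) g i (tnth x i) = \prod_(i < k) \int[mu_ i]_x g i x.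
  transitivity (\sum_(w : {ffun 'I_k -> 'I_r.+1})
      (\prod_(i < k) phi (w i)) *
      \prod_(i < k) fine (mu_ i (q i @^-1` [set w i]))).
    have bw (w : {ffun 'I_k -> 'I_r.+1}) : bdd_meas (fun x : k.-tuple X =>
        \prod_(i < k) \1_(q i @^-1` [set w i]) (tnth x i) : R).
      apply: (@bdd_meas_prod_tnth (fun i => \1_(q i @^-1` [set w i]))) => i.
      exact: bdd_meas_indic.
    under eq_Rintegral => x _.
      under eq_bigr do rewrite /g discretize_sum.
      rewrite bigA_distr_bigA /=.
      under eq_bigr do rewrite big_split.
      over.
    rewrite /= Rint_sum => [|w].
      apply: eq_bigr => w _; rewrite RintZ.
        by congr (_ * _); rewrite Rint_prod_indic.
      exact: bw.
    exact: bdd_measZ (bw w).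
  have Ei i : \int[mu_ i]_x g i x =
      \sum_a phi a * fine (mu_ i (q i @^-1` [set a])).
    under eq_Rintegral do rewrite /g discretize_sum.
    rewrite Rint_sum => [|a]; last exact/bdd_measZ/bdd_meas_indic.
    by apply: eq_bigr => a _; rewrite RintZ ?Rint_indic//; exact: bdd_meas_indic.
  under [RHS]eq_bigr do rewrite Ei.
  rewrite /= bigA_distr_bigA /=; apply: eq_bigr => w _.
  by rewrite big_split.
have h1 : `|\int[nu]_x \prod_(i < k) f i (tnth x i) -
    \int[nu]_x \prod_(i < k) g i (tnth x i)| <= e / 2.
  rewrite -RintB; [|exact: bdd_meas_prod_tnth..].
  apply: norm_Rint_le; first by apply: bdd_measB; exact: bdd_meas_prod_tnth.
  by move=> x; apply: hdel => i; [exact: fM|exact: fq].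
(* The integrals are bounded by M and move by at most [del], so [hdel] applies to them as it does to
   point values. *)
have h2 : `|\prod_(i < k) \int[mu_ i]_x f i x - \prod_(i < k) \int[mu_ i]_x g i x|
    <= e / 2.
  apply: hdel => i; first exact: norm_Rint_le.
  by rewrite -RintB//; apply: norm_Rint_le => //; exact: bdd_measB.
rewrite Eg in h1.
move: h1 h2; rewrite !ler_norml => /andP[? ?] /andP[? ?].
by apply/andP; split; lra.
Qed.

End ProductMeasure.

(** * Sums of product functions *)

Section ProductSums.
Context {R : realType} {d : measure_display} {X : measurableType d} {k : nat}.
Local Notation Y := (k.-tuple X).
Implicit Types H K F : Y -> R.

(** Sums and scalar multiples are constructors, so a property linear in H needs an argument only for
    a single product. *)
Inductive prodsum : (Y -> R) -> Prop :=
| prodsum_prod f : (forall i, bdd_meas (f i)) ->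
    prodsum (fun x => \prod_(i < k) f i (tnth x i))
| prodsumD H1 H2 : prodsum H1 -> prodsum H2 -> prodsum (fun x => H1 x + H2 x)
| prodsumZ c H1 : prodsum H1 -> prodsum (fun x => c * H1 x).

Lemma prodsum_bdd H : prodsum H -> bdd_meas H.
Proof.
elim=> [f|H1 H2 _ b1 _ b2|c H1 _ b1]; first exact: bdd_meas_prod_tnth.
- exact: bdd_measD.
- exact: bdd_measZ.
Qed.

Lemma prodsum_cst c : prodsum (fun=> c).
Proof.
rewrite (_ : (fun=> c) = fun x => c * \prod_(i < k) (fun _ _ => 1) i (tnth x i)).
  by apply/prodsumZ/(@prodsum_prod (fun _ _ => 1)) => i; exact: bdd_meas_cst.
by apply/funext => x; rewrite big1 ?mulr1.
Qed.

(** Needed to square a uniform limit of such sums. *)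
Lemma prodsumM H1 H2 : prodsum H1 -> prodsum H2 -> prodsum (fun x => H1 x * H2 x).
Proof.
move=> p1; elim: p1 H2 => [f bf|F G _ ihF _ ihG|c F _ ihF] H2 p2.
- elim: p2 => [g bg|F G _ ihF _ ihG|c F _ ihF].
  + under eq_fun do rewrite -big_split /=.
    apply: (@prodsum_prod (fun i s => f i s * g i s)) => i.
    exact: bdd_measM.
  + by under eq_fun do rewrite mulrDr; exact: prodsumD.
  + by under eq_fun do rewrite mulrCA; exact: prodsumZ.
- by under eq_fun do rewrite mulrDl; apply: prodsumD; [exact: ihF|exact: ihG].
- by under eq_fun do rewrite -mulrA; apply: prodsumZ; exact: ihF.
Qed.

Lemma prodsum_tnth j (f : X -> R) : bdd_meas f -> prodsum (fun x => f (tnth x j)).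
Proof.
move=> bf.
rewrite (_ : (fun x => _) = fun x : Y =>
    \prod_(i < k) (fun i => if i == j then f else cst 1) i (tnth x i)).
  apply: (@prodsum_prod (fun i => if i == j then f else cst 1)) => i.
  by case: eqP => // _; exact: bdd_meas_cst.
apply/funext => x; rewrite (bigD1 j)//= eqxx big1 ?mulr1// => i ij.
by rewrite (negPf ij).
Qed.

Variable nu : probability Y R.

Let approx F := bdd_meas F /\
  forall e, 0 < e -> exists2 H, prodsum H & \int[nu]_x `|F x - H x| <= e.

Let approxD F G : approx F -> approx G -> approx (fun x => F x + G x).
Proof.
move=> [bF aF] [bG aG]; split; first exact: bdd_measD.
move=> e e0; have [H1 p1 h1] := aF _ (divr_gt0 e0 (ltr0n _ 2)).
have [H2 p2 h2] := aG _ (divr_gt0 e0 (ltr0n _ 2)).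
exists (fun x => H1 x + H2 x); first exact: prodsumD.
have b1 := prodsum_bdd p1; have b2 := prodsum_bdd p2.
rewrite [e]splitr; apply: le_trans (lerD h1 h2).
rewrite -RintD; try by apply/bdd_meas_norm/bdd_measB.
apply: le_Rint.
- by apply/bdd_meas_norm/bdd_measB; exact: bdd_measD.
- by apply: bdd_measD; apply/bdd_meas_norm/bdd_measB.
- by move=> x; rewrite opprD addrACA; exact: ler_normD.
Qed.

Let approxZ c F : approx F -> approx (fun x => c * F x).
Proof.
move=> [bF aF]; split; first exact: bdd_measZ.
move=> e e0; have c0 : 0 < `|c| + 1 by rewrite ltr_wpDl.
have [H p h] := aF _ (divr_gt0 e0 c0).
exists (fun x => c * H x); first exact: prodsumZ.
have b := prodsum_bdd p.
under eq_Rintegral do rewrite -mulrBr normrM.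
rewrite RintZ; last exact/bdd_meas_norm/bdd_measB.
apply: le_trans (ler_wpM2l (normr_ge0 c) h) _.
rewrite mulrCA ler_piMr ?(ltW e0)//.
by rewrite ler_pdivrMr// mul1r lerDl.
Qed.

Let approx_sum (I : Type) (r : seq I) (F : I -> Y -> R) :
  (forall i, approx (F i)) -> approx (fun x => \sum_(i <- r) F i x).
Proof.
move=> aF; elim: r => [|i r ih].
  under eq_fun do rewrite big_nil; split; first exact: bdd_meas_cst.
  move=> e e0; exists (fun=> 0); first exact: prodsum_cst.
  by under eq_Rintegral do rewrite subrr normr0; rewrite Rint_cst ltW.
by under eq_fun do rewrite big_cons; exact: approxD.
Qed.

Let approx_prodsum H : prodsum H -> approx H.
Proof.
move=> p; split; [exact: prodsum_bdd|move=> e e0; exists H => //].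
by under eq_Rintegral do rewrite subrr normr0; rewrite Rint_cst ltW.
Qed.

Let approx_closed F : bdd_meas F -> (forall e, 0 < e ->
  exists2 G, approx G & \int[nu]_x `|F x - G x| <= e) -> approx F.
Proof.
move=> bF aF; split=> // e e0.
have [G [bG aG] h1] := aF _ (divr_gt0 e0 (ltr0n _ 2)).
have [H p h2] := aG _ (divr_gt0 e0 (ltr0n _ 2)).
exists H => //; have b := prodsum_bdd p.
rewrite [e]splitr; apply: le_trans (lerD h1 h2).
rewrite -RintD; try by apply/bdd_meas_norm/bdd_measB.
apply: le_Rint.
- by apply/bdd_meas_norm/bdd_measB.
- by apply: bdd_measD; apply/bdd_meas_norm/bdd_measB.
- by move=> x; rewrite -[F x - H x](subrKA (G x)); exact: ler_normD.
Qed.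

(** The measurable sets whose indicator is an L1 limit of sums of products form a Dynkin system
    containing the rectangles. *)
Let approx_indic B : measurable B -> approx (\1_B).
Proof.
pose DD := [set B : set Y | measurable B /\ approx (\1_B)].
suff : measurable `<=` DD by move=> h /h[].
apply: mrects_dynkin; last first.
  move=> _ [A mA <-]; split; first exact: measurable_rect.
  apply: approx_prodsum.
  rewrite (_ : \1_(rect A) = fun x => \prod_(i < k) (fun i => \1_(A i)) i (tnth x i)).
    by apply: (@prodsum_prod (fun i => \1_(A i))) => i; exact: bdd_meas_indic.
  apply/funext => x; exact: indic_rect.
split.
- split; first exact: measurableT.
  rewrite indicT; apply: approx_prodsum; exact: prodsum_cst.
- move=> A [mA aA]; split; first exact: measurableC.
  rewrite (_ : \1_(~` A) = fun x => 1 + (-1) * \1_A x).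
    by apply: approxD; [exact/approx_prodsum/prodsum_cst|exact: approxZ].
  apply/funext => x; rewrite indicC indicE mulN1r.
  by case: (x \in A); rewrite /= ?subrr ?subr0.
- move=> F tF hF.
  have mF i : measurable (F i) by have [] := hF i.
  have mU : measurable (\bigcup_i F i) by exact: bigcupT_measurable.
  split=> //; apply: approx_closed; first exact: bdd_meas_indic.
  move=> e e0.
  have fU C : measurable C -> (fine (nu C))%:E = nu C.
    by move=> mC; rewrite fineK// fin_num_measure.
  (* The L1 error of the n-th partial sum of indicators is the measure of the remaining sets, which
     tends to 0. *)
  have cv : (fun n => (\sum_(0 <= i < n) fine (nu (F i)))%:E) @ \oo -->
      (fine (nu (\bigcup_i F i)))%:E.
    rewrite fU//; apply: cvg_trans (measure_semi_sigma_additive F mF tF mU).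
    apply: near_eq_cvg; near=> n; rewrite /= -sumEFin.
    by apply: eq_bigr => i _; rewrite fU.
  have /fine_cvgP[_ /cvgrPdist_le /(_ _ e0)[n _ /(_ n (leqnn n)) /= hn]] := cv.
  exists (fun x => \sum_(0 <= i < n) \1_(F i) x).
    by apply: approx_sum => i; have [] := hF i.
  apply: le_trans hn.
  have bS : bdd_meas (fun x => \sum_(0 <= i < n) \1_(F i) x : R).
    by apply: bdd_meas_sum => i; exact: bdd_meas_indic.
  have ES : \sum_(0 <= i < n) fine (nu (F i)) =
      \int[nu]_x \sum_(0 <= i < n) \1_(F i) x.
    rewrite Rint_sum => [|i]; last exact: bdd_meas_indic.
    by apply: eq_bigr => i _; rewrite Rint_indic.
  rewrite ES -Rint_indic// -RintB//; last exact: bdd_meas_indic.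
  apply: le_trans (ler_norm _); rewrite le_eqVlt; apply/orP; left; apply/eqP.
  apply: eq_Rintegral => x _; rewrite ger0_norm// subr_ge0.
  have [[j _ Fj]|nF] := pselect ((\bigcup_i F i) x); last first.
    rewrite big1 ?ler0n// => i _; rewrite indicE memNset// => Fi.
    by apply: nF; exists i.
  rewrite [leRHS]indicE mem_set/=; last by exists j.
  (* By disjointness x lies in no set but the j-th, so the indicators are dominated by a Kronecker
     delta. *)
  apply: (@le_trans _ _ (\sum_(0 <= i < n) (i == j)%:R)).
    apply: ler_sum => i _; rewrite indicE; have [->|ij] := eqVneq i j.
      by case: (_ \in _).
    rewrite memNset// => Fi; move/eqP: ij; apply.
    by apply: (tF i j) => //; exists x.
  rewrite -natr_sum ler_nat big_mkord.
  have [nj|nj] := ltnP j n.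
    by rewrite (bigD1 (Ordinal nj))//= eqxx big1 ?addn0// => i /negPf; rewrite -val_eqE /= => ->.
  rewrite big1// => i _; case: eqP => // ij.
  by have := ltn_ord i; rewrite ij ltnNge nj.
Unshelve. all: by end_near.
Qed.

Lemma prodsum_dense F e : bdd_meas F -> 0 < e ->
  exists2 H, prodsum H & \int[nu]_x `|F x - H x| <= e.
Proof.
move=> bF; suff [_] : approx F by exact.
apply: approx_closed => // {}e e0.
have [r [phi [q [mq fq]]]] := discretize (fun _ : unit => bF) e0.
pose G x := \sum_a phi a * \1_(q tt @^-1` [set a]) x.
have aG : approx G by apply: approx_sum => a; exact/approxZ/approx_indic.
exists G => //; rewrite -(Rint_cst nu e); apply: le_Rint.
- by apply/bdd_meas_norm/bdd_measB => //; case: aG.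
- exact: bdd_meas_cst.
- by move=> x; rewrite /G -discretize_sum; exact: fq.
Qed.

(** F is orthogonal to every sum H of products, so int F^2 = int F (F - H), at most sup |F| times
    the L1 distance of F to H, which density makes small. *)
Lemma prodsum_null F : bdd_meas F ->
  (forall f : 'I_k -> X -> R, (forall i, bdd_meas (f i)) ->
    \int[nu]_x (F x * \prod_(i < k) f i (tnth x i)) = 0) ->
  \int[nu]_x F x ^+ 2 = 0.
Proof.
move=> bF F0.
have FH H : prodsum H -> \int[nu]_x (F x * H x) = 0.
  elim=> [f bf|H1 H2 p1 ih1 p2 ih2|c H1 p1 ih1]; first exact: F0.
  - under eq_Rintegral do rewrite mulrDr.
    by rewrite RintD ?ih1 ?ih2 ?addr0//; apply: bdd_measM => //; exact: prodsum_bdd.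
  - under eq_Rintegral do rewrite mulrCA.
    by rewrite RintZ ?ih1 ?mulr0//; apply: bdd_measM => //; exact: prodsum_bdd.
have [M M0 FM] := bdd_meas_bound bF.
apply/eqP; rewrite -normr_le0; apply/ler_addgt0Pr => e e0; rewrite add0r.
have [H p h] := prodsum_dense bF (divr_gt0 e0 M0).
have bH := prodsum_bdd p.
have -> : \int[nu]_x F x ^+ 2 = \int[nu]_x (F x * (F x - H x)).
  under [RHS]eq_Rintegral do rewrite mulrBr.
  rewrite RintB ?(FH _ p) ?subr0//; exact: bdd_measM.
apply: le_trans (norm_Rint _ _) _; first by apply: bdd_measM => //; exact: bdd_measB.
apply: (@le_trans _ _ (\int[nu]_x (M * `|F x - H x|))).
  apply: le_Rint.
  - by apply/bdd_meas_norm/bdd_measM => //; exact: bdd_measB.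
  - by apply/bdd_measZ/bdd_meas_norm/bdd_measB.
  - by move=> x; rewrite normrM ler_wpM2r.
rewrite RintZ; last exact/bdd_meas_norm/bdd_measB.
by rewrite mulrC -ler_pdivlMr.
Qed.

End ProductSums.

(** * Smoothing an invariant function in one coordinate *)

Section Smoothing.
Context {R : realType} {d : measure_display} {X : measurableType d} {k : nat}.
Local Notation Y := (k.-tuple X).
Variables (mu_ : 'I_k -> probability X R) (nu : probability Y R).
Hypothesis hnu : is_product_measure (fun i => mu_ i) nu.

Lemma measurable_tnth_comp d' (Z : measurableType d') (g : Z -> Y) i :
  measurable_fun setT g -> measurable_fun setT (fun z => tnth (g z) i).
Proof. by move=> mg; apply: (measurableT_comp (measurable_tnth i)). Qed.

Lemma bdd_meas_upd d' (Z : measurableType d') (K : Y -> R) i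
    (g : Z -> Y) (h : Z -> X) : bdd_meas K ->
  measurable_fun setT g -> measurable_fun setT h ->
  bdd_meas (fun z => K (upd i (g z) (h z))).
Proof. by move=> bK mg mh; apply: (bdd_meas_comp bK); exact: measurable_upd. Qed.

Lemma bdd_meas_ker d' (Z : measurableType d') (Phi : X * X -> R) i
    (g h : Z -> Y) : bdd_meas Phi ->
  measurable_fun setT g -> measurable_fun setT h ->
  bdd_meas (fun z => Phi (tnth (g z) i, tnth (h z) i)).
Proof.
move=> bP mg mh; apply: (bdd_meas_comp bP).
by apply: measurable_fun_pair; exact: measurable_tnth_comp.
Qed.

(** The new j-th coordinate is read off a fresh tuple w of law [nu], which amounts to drawing it
    from [mu_ j]; all integrals are then over [nu] and [Rint_upd] applies. *)
Definition smooth (Phi : X * X -> R) (j : 'I_k) (K : Y -> R) (x : Y) : R :=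
  \int[nu]_w (Phi (tnth x j, tnth w j) * K (upd j x (tnth w j))).

Lemma bdd_meas_smooth2 (Phi : X * X -> R) j (K : Y -> R) :
  bdd_meas Phi -> bdd_meas K ->
  bdd_meas (fun z : Y * Y =>
    Phi (tnth z.1 j, tnth z.2 j) * K (upd j z.1 (tnth z.2 j))).
Proof.
move=> bP bK; apply: bdd_measM; first exact: bdd_meas_ker.
by apply: bdd_meas_upd => //; exact: measurable_tnth_comp.
Qed.

Lemma bdd_meas_smooth1 (Phi : X * X -> R) j (K : Y -> R) x :
  bdd_meas Phi -> bdd_meas K ->
  bdd_meas (fun w : Y => Phi (tnth x j, tnth w j) * K (upd j x (tnth w j))).
Proof. by move=> bP bK; exact: bdd_meas_pair1 (bdd_meas_smooth2 j bP bK) x. Qed.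

Lemma bdd_meas_smooth (Phi : X * X -> R) j (K : Y -> R) :
  bdd_meas Phi -> bdd_meas K -> bdd_meas (smooth Phi j K).
Proof.
by move=> bP bK; exact: (bdd_meas_Rint2 nu nu (bdd_meas_smooth2 j bP bK)).
Qed.

(** On a product function only the j-th factor changes: it becomes s |-> int Phi(s, w_j)
    f_j(w_j). *)
Lemma smooth_prodsum (Phi : X * X -> R) j (H : Y -> R) :
  bdd_meas Phi -> prodsum H -> prodsum (smooth Phi j H).
Proof.
move=> bP; rewrite /smooth; elim=> [f bf|H1 H2 p1 ih1 p2 ih2|c H1 p1 ih1].
- pose g i := if i == j then
    fun s => \int[nu]_w (Phi (s, tnth w j) * f j (tnth w j)) else f i.
  rewrite (_ : (fun x => _) = fun x => \prod_(i < k) g i (tnth x i)).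
    apply: prodsum_prod => i; rewrite /g; case: eqP => // _.
    have b2 : bdd_meas (fun z : X * Y => Phi (z.1, tnth z.2 j) * f j (tnth z.2 j)).
      apply: bdd_measM.
        apply: (bdd_meas_comp bP); apply: measurable_fun_pair => //.
        exact: measurable_tnth_comp.
      by apply: (bdd_meas_comp (bf j)); exact: measurable_tnth_comp.
    exact: (bdd_meas_Rint2 (mu_ j) nu b2).
  apply/funext => x.
  rewrite [RHS](bigD1 j)//= {1}/g eqxx mulrC -RintZ; last first.
    apply: bdd_measM.
      apply: (bdd_meas_comp bP); apply: measurable_fun_pair => //.
      exact: measurable_tnth_comp.
    by apply: (bdd_meas_comp (bf j)); exact: measurable_tnth_comp.
  apply: eq_Rintegral => w _; rewrite (bigD1 j)//= tnth_upd eqxx.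
  rewrite (eq_bigr (fun i => g i (tnth x i))) => [|i ij]; first by ring.
  by rewrite tnth_upd /g (negPf ij).
- rewrite (_ : (fun x => _) = fun x => smooth Phi j H1 x + smooth Phi j H2 x).
    exact: prodsumD.
  apply/funext => x; rewrite /smooth -RintD; first last.
  - by apply: bdd_meas_smooth1 => //; exact: prodsum_bdd.
  - by apply: bdd_meas_smooth1 => //; exact: prodsum_bdd.
  by apply: eq_Rintegral => w _; rewrite mulrDr.
- rewrite (_ : (fun x => _) = fun x => c * smooth Phi j H1 x).
    exact: prodsumZ.
  apply/funext => x; rewrite /smooth -RintZ; last first.
    by apply: bdd_meas_smooth1 => //; exact: prodsum_bdd.
  by apply: eq_Rintegral => w _; rewrite mulrCA.
Qed.

Definition merge (n : nat) (x z : Y) : Y :=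
  [tuple if (i < n)%N then tnth x i else tnth z i | i < k].

(** Once coordinate j is overwritten, it does not matter whether it was frozen: a function smoothed
    in j, taken with j + 1 frozen coordinates, only sees values of K with j frozen ones. *)
Lemma upd_merge (j : 'I_k) x z s : upd j (merge j.+1 x z) s = merge j x (upd j z s).
Proof.
apply: eq_from_tnth => i; rewrite tnth_upd !tnth_mktuple ltnS.
case: (ltngtP i j) => [ij|ij|/val_inj ->].
- by rewrite -val_eqE /= ltn_eqF.
- by rewrite -val_eqE /= gtn_eqF.
- by rewrite eqxx.
Qed.

Lemma merge0 x z : merge 0 x z = z.
Proof. by apply: eq_from_tnth => i; rewrite tnth_mktuple. Qed.

Lemma merge_all x z : merge k x z = x.
Proof. by apply: eq_from_tnth => i; rewrite tnth_mktuple ltn_ord. Qed.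

Lemma measurable_merge n x : measurable_fun setT (merge n x).
Proof.
apply/measurable_fun_tnthP => i.
rewrite (_ : _ \o _ = fun z => if (i < n)%N then tnth x i else tnth z i).
  by case: (i < n)%N; [exact: measurable_cst|exact: measurable_tnth].
by apply/funext => z /=; rewrite tnth_mktuple.
Qed.

(* Uniform in the first [n] coordinates, L1 in the others; for [n = 0] this is
   L1 approximation and for [n = k] uniform approximation. *)
Definition approx_upto (n : nat) (K : Y -> R) : Prop :=
  forall e, 0 < e -> exists2 H, prodsum H &
    forall x, \int[nu]_z `|K (merge n x z) - H (merge n x z)| <= e.

Lemma approx_upto0 K : bdd_meas K -> approx_upto 0 K.
Proof.
move=> bK e e0; have [H p h] := prodsum_dense nu bK e0.
by exists H => // x; under eq_Rintegral do rewrite merge0.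
Qed.

(** With j + 1 coordinates frozen, the smoothed functions differ by at most sup |Phi| times the
    average of |K - H| over coordinate j, which is thereby released. Integrating over z and undoing
    the resampling gives the hypothesis for j. *)
Lemma approx_uptoS (Phi : X * X -> R) (j : 'I_k) K : bdd_meas Phi -> bdd_meas K ->
  approx_upto j K -> approx_upto j.+1 (smooth Phi j K).
Proof.
move=> bP bK aK e e0; have [M M0 PM] := bdd_meas_bound bP.
have [H p h] := aK _ (divr_gt0 e0 M0); have bH := prodsum_bdd p.
exists (smooth Phi j H); first exact: smooth_prodsum.
move=> x; set m := merge j.+1 x.
have mm : measurable_fun setT m by exact: measurable_merge.
have bKH : bdd_meas (fun y => `|K (merge j x y) - H (merge j x y)|).
  apply: bdd_meas_norm; apply: bdd_measB.
    exact: (bdd_meas_comp bK (@measurable_merge _ _)).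
  exact: (bdd_meas_comp bH (@measurable_merge _ _)).
have bKH2 : bdd_meas (fun z : Y * Y =>
    `|K (merge j x (upd j z.1 (tnth z.2 j))) - H (merge j x (upd j z.1 (tnth z.2 j)))|).
  by apply: (bdd_meas_upd (K := fun y => `|K (merge j x y) - H (merge j x y)|)) => //;
    exact: measurable_tnth_comp.
apply: (@le_trans _ _ (M * \int[nu]_z \int[nu]_w
    `|K (merge j x (upd j z (tnth w j))) - H (merge j x (upd j z (tnth w j)))|)).
  rewrite -RintZ; last exact: (bdd_meas_Rint2 nu nu bKH2).
  apply: le_Rint.
  - apply: bdd_meas_norm; apply: bdd_measB.
      by apply: (bdd_meas_comp (bdd_meas_smooth j bP bK)).
    by apply: (bdd_meas_comp (bdd_meas_smooth j bP bH)).
  - by apply: bdd_measZ; exact: (bdd_meas_Rint2 nu nu bKH2).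
  - move=> z; rewrite /smooth -RintB; try exact: bdd_meas_smooth1.
    apply: le_trans (norm_Rint _ _) _.
      by apply: bdd_measB; exact: bdd_meas_smooth1.
    rewrite -RintZ; last exact: (bdd_meas_pair1 bKH2).
    apply: le_Rint.
    + by apply: bdd_meas_norm; apply: bdd_measB; exact: bdd_meas_smooth1.
    + by apply: bdd_measZ; exact: (bdd_meas_pair1 bKH2).
    + by move=> w; rewrite -mulrBr normrM -upd_merge ler_wpM2r.
by rewrite (Rint_upd hnu j bKH) mulrC -ler_pdivlMr.
Qed.

Definition corr (j : 'I_k) (K : Y -> R) (st : X * X) : R :=
  \int[nu]_v (K (upd j v st.1) * K (upd j v st.2)).

Section Correlation.
Variables (j : 'I_k) (K : Y -> R).
Hypothesis bK : bdd_meas K.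

Lemma bdd_meas_corr : bdd_meas (corr j K).
Proof.
have b : bdd_meas (fun z : (X * X) * Y => K (upd j z.2 z.1.1) * K (upd j z.2 z.1.2)).
  apply: bdd_measM; apply: bdd_meas_upd => //.
  - by apply: (measurableT_comp measurable_fst measurable_fst).
  - by apply: (measurableT_comp measurable_snd measurable_fst).
exact: (bdd_meas_Rint2 (prob_prod (mu_ j) (mu_ j)) nu b).
Qed.

Let bC := bdd_meas_corr.

(** Serves to show that smoothing keeps the mean zero: the right-hand side pairs K with a function
    of one coordinate. Coordinate j is resampled on both sides and the two integrations are
    exchanged. *)
Lemma Rint_smooth :
  \int[nu]_x smooth (corr j K) j K x =
  \int[nu]_y (K y * \int[nu]_x corr j K (tnth x j, tnth y j)).
Proof.
have bP2 : bdd_meas (fun z : Y * Y => corr j K (tnth z.1 j, tnth z.2 j)).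
  exact: bdd_meas_ker.
rewrite -(Rint_upd hnu j (bdd_meas_smooth j bC bK)).
have bG : bdd_meas (fun y => K y * \int[nu]_x corr j K (tnth x j, tnth y j)).
  by apply: bdd_measM => //; exact: (bdd_meas_Rint1 nu nu bP2).
rewrite -[RHS](Rint_upd hnu j bG); apply: eq_Rintegral => x _.
rewrite /smooth.
under eq_Rintegral => z _.
  under eq_Rintegral => w _ do rewrite tnth_upd eqxx upd_upd.
  over.
have b : bdd_meas (fun z : Y * Y =>
    corr j K (tnth z.1 j, tnth z.2 j) * K (upd j x (tnth z.2 j))).
  by apply: bdd_measM => //; apply: bdd_meas_upd => //; exact: measurable_tnth_comp.
rewrite /= (Rint_swap nu nu b) /=; apply: eq_Rintegral => w _.
rewrite tnth_upd eqxx -RintZ; last exact: (bdd_meas_pair2 bP2).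
by apply: eq_Rintegral => z _; rewrite mulrC.
Qed.

(** The Hilbert-Schmidt identity <A, A A' A> = |A' A|^2: once coordinate j is resampled, integrating
    the two values of K over the common x yields a second factor [corr]. *)
Lemma Rint_mul_smooth :
  \int[nu]_x (K x * smooth (corr j K) j K x) =
  \int[prob_prod nu nu]_z (corr j K (tnth z.1 j, tnth z.2 j)) ^+ 2.
Proof.
rewrite -(Rint_upd hnu j (bdd_measM bK (bdd_meas_smooth j bC bK))).
have b4 : bdd_meas (fun z : Y * (Y * Y) =>
    corr j K (tnth z.2.1 j, tnth z.2.2 j) *
    (K (upd j z.1 (tnth z.2.1 j)) * K (upd j z.1 (tnth z.2.2 j)))).
  have m1 : measurable_fun setT (fun z : Y * (Y * Y) => z.2.1).
    exact: (measurableT_comp measurable_fst measurable_snd).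
  have m2 : measurable_fun setT (fun z : Y * (Y * Y) => z.2.2).
    exact: (measurableT_comp measurable_snd measurable_snd).
  apply: bdd_measM; first exact: bdd_meas_ker.
  by apply: bdd_measM; apply: bdd_meas_upd => //; exact: measurable_tnth_comp.
transitivity (\int[nu]_x \int[prob_prod nu nu]_z
    (corr j K (tnth z.1 j, tnth z.2 j) *
    (K (upd j x (tnth z.1 j)) * K (upd j x (tnth z.2 j))))).
  apply: eq_Rintegral => x _.
  rewrite (Rint_prod12 nu nu (bdd_meas_pair1 b4 x)) /=.
  apply: eq_Rintegral => z _; rewrite /smooth -RintZ; last exact: bdd_meas_smooth1.
  by apply: eq_Rintegral => w _; rewrite tnth_upd eqxx upd_upd mulrCA.
rewrite (Rint_swap nu (prob_prod nu nu) b4) /=; apply: eq_Rintegral => -[z w] _ /=.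
rewrite RintZ ?expr2//.
by apply: bdd_measM; apply: bdd_meas_upd => //; exact: measurable_cst.
Qed.

(** K times its smoothing integrates to 0, so [corr] vanishes in L2. Hence integrating K against any
    f_j in coordinate j gives 0 almost everywhere in the other coordinates, and K is orthogonal to
    every product function. *)
Lemma smooth_null : \int[nu]_x smooth (corr j K) j K x ^+ 2 = 0 ->
  \int[nu]_x K x ^+ 2 = 0.
Proof.
move=> /(fun h => Rint_null_mul (bdd_meas_smooth j bC bK) bK h).
under eq_Rintegral do rewrite mulrC.
rewrite Rint_mul_smooth => C0.
have bP2 : bdd_meas (fun z : Y * Y => corr j K (tnth z.1 j, tnth z.2 j)).
  exact: bdd_meas_ker.
apply: prodsum_null => // f bf.
pose g (x : Y) := \prod_(i < k | i != j) f i (tnth x i).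
have bg : bdd_meas g.
  apply: bdd_meas_prod => i; apply: (bdd_meas_comp (bf i)).
  exact: measurable_tnth.
have bff : bdd_meas (fun z : Y * Y => f j (tnth z.1 j) * f j (tnth z.2 j)).
  by apply: bdd_measM; apply: (bdd_meas_comp (bf j)); exact: measurable_tnth_comp.
have bA : bdd_meas (fun z : Y * Y => K (upd j z.1 (tnth z.2 j)) * f j (tnth z.2 j)).
  apply: bdd_measM; last by apply: (bdd_meas_comp (bf j)); exact: measurable_tnth_comp.
  by apply: bdd_meas_upd => //; exact: measurable_tnth_comp.
(* The operator with kernel K applied to f_j; its square integrates to the double integral of [corr]
   against f_j(s) f_j(t). *)
pose h x := \int[nu]_z (K (upd j x (tnth z j)) * f j (tnth z j)).
have bh : bdd_meas h by exact: (bdd_meas_Rint2 nu nu bA).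
have h0 : \int[nu]_x h x ^+ 2 = 0.
  have := Rint_null_mul bP2 bff C0.
  have b4 : bdd_meas (fun z : Y * (Y * Y) =>
      (K (upd j z.1 (tnth z.2.1 j)) * f j (tnth z.2.1 j)) *
      (K (upd j z.1 (tnth z.2.2 j)) * f j (tnth z.2.2 j))).
    have m1 : measurable_fun setT (fun z : Y * (Y * Y) => (z.1, z.2.1)).
      apply: measurable_fun_pair => //.
      exact: (measurableT_comp measurable_fst measurable_snd).
    have m2 : measurable_fun setT (fun z : Y * (Y * Y) => (z.1, z.2.2)).
      apply: measurable_fun_pair => //.
      exact: (measurableT_comp measurable_snd measurable_snd).
    by apply: bdd_measM; [exact: (bdd_meas_comp bA m1)|exact: (bdd_meas_comp bA m2)].
  move=> <-.
  transitivity (\int[nu]_x \int[prob_prod nu nu]_z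
      ((K (upd j x (tnth z.1 j)) * f j (tnth z.1 j)) *
       (K (upd j x (tnth z.2 j)) * f j (tnth z.2 j)))).
    apply: eq_Rintegral => x _.
    rewrite (Rint_prod12 nu nu (bdd_meas_pair1 b4 x)) /=.
    have bAx := bdd_meas_pair1 bA x.
    rewrite expr2 -RintZ//; apply: eq_Rintegral => z _.
    by rewrite RintZ//= mulrC.
  rewrite (Rint_swap nu (prob_prod nu nu) b4) /=; apply: eq_Rintegral => -[z w] _ /=.
  rewrite mulrC -RintZ; last first.
    by apply: bdd_measM; apply: bdd_meas_upd => //; exact: measurable_cst.
  by apply: eq_Rintegral => x _; ring.
have := Rint_null_mul bh bg h0.
have bKf : bdd_meas (fun x => K x * \prod_(i < k) f i (tnth x i)).
  by apply: bdd_measM => //; exact: bdd_meas_prod_tnth.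
rewrite -(Rint_upd hnu j bKf) => <-.
apply: eq_Rintegral => x _; rewrite mulrC -RintZ; last exact: (bdd_meas_pair1 bA).
apply: eq_Rintegral => z _; rewrite (bigD1 j)//= tnth_upd eqxx.
rewrite (_ : \prod_(i < k | i != j) _ = g x); first by ring.
by apply: eq_bigr => i ij; rewrite tnth_upd (negPf ij).
Qed.

Variable T : 'I_k -> X -> X.
Hypothesis mT : forall i, measurable_fun setT (T i).
Hypothesis iT : forall i, invariant_measure (T i) (mu_ i).
Hypothesis KT : forall x, K (tuple_map T x) = K x.

(** The integration variable v is replaced by its image under the product map, which preserves [nu];
    the invariance of K then removes the map. *)
Lemma corr_inv s t : corr j K (T j s, T j t) = corr j K (s, t).
Proof.
rewrite /corr -(Rint_tuple_map hnu mT iT) /=.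
  by apply: eq_Rintegral => v _; rewrite -!tuple_map_upd !KT.
by apply: bdd_measM; apply: bdd_meas_upd => //; exact: measurable_cst.
Qed.

Lemma smooth_inv x : smooth (corr j K) j K (tuple_map T x) = smooth (corr j K) j K x.
Proof.
rewrite /smooth -(Rint_tuple_map hnu mT iT) /=; last exact: bdd_meas_smooth1.
by apply: eq_Rintegral => w _; rewrite !tnth_mktuple corr_inv -tuple_map_upd KT.
Qed.

End Correlation.

End Smoothing.

(** * Ergodicity of the product from weak convergence on the diagonal *)

Section Averages.
Context {R : realType}.
Implicit Types (u v : nat -> R) (M N : nat).

Definition avg M N u : R := (N - M)%:R^-1 * \sum_(M <= n < N) u n.

Lemma avgD M N u v : avg M N (fun n => u n + v n) = avg M N u + avg M N v.
Proof. by rewrite /avg big_split mulrDr. Qed.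

Lemma avgZ M N c u : avg M N (fun n => c * u n) = c * avg M N u.
Proof. by rewrite /avg -mulr_sumr mulrCA. Qed.

Lemma avg_cst M N c : (M < N)%N -> avg M N (fun=> c) = c.
Proof.
move=> MN; rewrite /avg sumr_const_nat -[c *+ _]mulr_natl mulKf//.
by rewrite pnatr_eq0 subn_eq0 -ltnNge.
Qed.

Lemma avgB M N u v : avg M N (fun n => u n - v n) = avg M N u - avg M N v.
Proof.
rewrite -mulN1r -avgZ -avgD; congr avg.
by apply/funext => n; rewrite mulN1r.
Qed.

Lemma le_avg M N u v : (forall n, (M <= n < N)%N -> u n <= v n) ->
  avg M N u <= avg M N v.
Proof. by move=> uv; rewrite ler_wpM2l ?invr_ge0 ?ler0n// ler_sum_nat. Qed.

Lemma norm_avg M N u : `|avg M N u| <= avg M N (fun n => `|u n|).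
Proof.
rewrite /avg normrM ger0_norm ?invr_ge0 ?ler0n//.
by rewrite ler_wpM2l ?invr_ge0 ?ler0n// ler_norm_sum.
Qed.

Lemma norm_avg_le M N u b : (M < N)%N ->
  (forall n, (M <= n < N)%N -> `|u n| <= b) -> `|avg M N u| <= b.
Proof.
by move=> MN ub; apply: le_trans (norm_avg _ _ _) _; rewrite -(avg_cst b MN) le_avg.
Qed.

(** The variance of u over the window is non-negative. *)
Lemma avg_sqr M N u : (M < N)%N -> avg M N u ^+ 2 <= avg M N (fun n => u n ^+ 2).
Proof.
move=> MN; set a := avg M N u.
have : 0 <= avg M N (fun n => (u n - a) ^+ 2).
  by rewrite -(@avg_cst M N 0)// le_avg// => n _; rewrite sqr_ge0.
rewrite (_ : (fun n => _) = fun n => u n ^+ 2 + (- (2 * a)) * u n + a ^+ 2).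
  by rewrite !avgD avgZ avg_cst// -/a; lra.
by apply/funext => n; ring.
Qed.

Lemma avg_exchange M N M' N' (u : nat -> nat -> R) :
  avg M N (fun n => avg M' N' (u n)) = avg M' N' (fun l => avg M N (u ^~ l)).
Proof.
rewrite /avg -mulr_sumr -[in RHS]mulr_sumr mulrCA; congr (_ * (_ * _)).
exact: exchange_big.
Qed.

(** Each shift by one telescopes to the two end terms, each at most b in absolute value. *)
Lemma avg_shift M N u b l : (M < N)%N -> (forall n, `|u n| <= b) ->
  `|avg M N (fun n => u (n + l)%N) - avg M N u| <= 2 * b * l%:R / (N - M)%:R.
Proof.
move=> MN ub; elim: l => [|l ih].
  under [X in avg M N X]eq_fun do rewrite addn0.
  by rewrite subrr normr0 mulr0 mul0r.
have h : `|avg M N (fun n => u (n + l.+1)%N) - avg M N (fun n => u (n + l)%N)| <=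
    2 * b / (N - M)%:R.
  rewrite -avgB /avg normrM ger0_norm ?invr_ge0 ?ler0n// [leRHS]mulrC.
  rewrite ler_wpM2l ?invr_ge0 ?ler0n//.
  pose v n := u (n + l)%N.
  rewrite (eq_bigr (fun n => v n.+1 - v n)); last first.
    by move=> n _; rewrite /v addnS addSn.
  rewrite (telescope_sumr v (ltnW MN)).
  apply: le_trans (ler_normB _ _) _.
  by have := ub (N + l)%N; have := ub (M + l)%N; rewrite /v; lra.
rewrite -(subrKA (avg M N (fun n => u (n + l)%N))).
apply: le_trans (ler_normD _ _) (le_trans (lerD h ih) _).
by rewrite -[l.+1%:R]natr1 mulrDr mulr1 mulrDl addrC.
Qed.

Lemma cvg_diffD (a b : nat -> nat -> R) s t : cvg_diff a s -> cvg_diff b t ->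
  cvg_diff (fun M N => a M N + b M N) (s + t).
Proof.
move=> ha hb e e0.
have [L1 h1] := ha _ (divr_gt0 e0 (ltr0n _ 2)).
have [L2 h2] := hb _ (divr_gt0 e0 (ltr0n _ 2)).
exists (maxn L1 L2) => M N MN; rewrite geq_max => /andP[l1 l2].
rewrite opprD addrACA (le_lt_trans (ler_normD _ _))// [e]splitr ltrD//.
  exact: h1.
exact: h2.
Qed.

Lemma cvg_diffZ c (a : nat -> nat -> R) s : cvg_diff a s ->
  cvg_diff (fun M N => c * a M N) (c * s).
Proof.
move=> ha e e0; have c0 : 0 < `|c| + 1 by rewrite ltr_wpDl.
have [L h] := ha _ (divr_gt0 e0 c0).
exists L => M N MN LMN; rewrite -mulrBr normrM.
have := h M N MN LMN; rewrite ltr_pdivlMr// => /(le_lt_trans _); apply.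
by rewrite mulrC ler_wpM2l// lerDl.
Qed.

End Averages.

(** * Orbits of diagonal points under the product map *)

Section Diagonal.
Context {R : realType} {d : measure_display} {X : measurableType d} {k : nat}.
Local Notation Y := (k.-tuple X).
Variable (T : 'I_k -> X -> X).
Hypothesis mT : forall i, measurable_fun setT (T i).
Local Notation S := (tuple_map T).

Definition diag (x : X) : Y := [tuple x | i < k].

Lemma tnth_iter_tuple_map n (y : Y) i : tnth (iter n S y) i = iter n (T i) (tnth y i).
Proof. by elim: n => //= n ih; rewrite tnth_mktuple ih. Qed.

Lemma tnth_iter_diag n x i : tnth (iter n S (diag x)) i = iter n (T i) x.
Proof. by rewrite tnth_iter_tuple_map tnth_mktuple. Qed.

Lemma measurable_diag : measurable_fun setT diag.
Proof.
apply/measurable_fun_tnthP => i; rewrite (_ : _ \o _ = id)//.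
by apply/funext => x /=; rewrite tnth_mktuple.
Qed.

Lemma measurable_iter_diag n : measurable_fun setT (fun x => iter n S (diag x)).
Proof.
have mS := measurable_iter n (measurable_tuple_map mT).
exact: (measurableT_comp mS measurable_diag).
Qed.

End Diagonal.

Section WeakToErgodic.
Context {R : realType} {d : measure_display} {X : measurableType d} {k : nat}.
Local Notation Y := (k.-tuple X).
Variables (mu : probability X R) (mu_ : 'I_k -> probability X R).
Variable nu : probability Y R.
Hypothesis hnu : is_product_measure (fun i => mu_ i) nu.
Variable T : 'I_k -> X -> X.
Hypothesis mT : forall i, measurable_fun setT (T i).
Hypothesis iT : forall i, invariant_measure (T i) (mu_ i).
Local Notation S := (tuple_map T).

Hypothesis weak : forall (f0 : X -> R) (f : 'I_k -> X -> R), bdd_meas f0 ->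
  (forall i, bdd_meas (f i)) ->
  cvg_diff
    (fun M N => (N - M)%:R^-1 * \sum_(M <= n < N)
       \int[mu]_x (f0 x * \prod_(i < k) f i (iter n (T i) x)))
    ((\int[mu]_x f0 x) * \prod_(i < k) \int[mu_ i]_x f i x).

Lemma weak_prodsum (f0 : X -> R) (H : Y -> R) : bdd_meas f0 -> prodsum H ->
  cvg_diff (fun M N => avg M N (fun n => \int[mu]_x (f0 x * H (iter n S (diag x)))))
    ((\int[mu]_x f0 x) * \int[nu]_y H y).
Proof.
move=> b0; elim=> [f bf|H1 H2 p1 ih1 p2 ih2|c H1 p1 ih1].
- rewrite (Rint_prod_tnth hnu bf); have := weak b0 bf.
  congr (cvg_diff _ _); apply/funext => M; apply/funext => N.
  congr (_ * _); apply: eq_bigr => n _; apply: eq_Rintegral => x _.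
  by congr (_ * _); apply: eq_bigr => i _; rewrite tnth_iter_diag.
- have b1 := prodsum_bdd p1; have b2 := prodsum_bdd p2.
  rewrite RintD// mulrDr; have := cvg_diffD ih1 ih2.
  congr (cvg_diff _ _); apply/funext => M; apply/funext => N.
  rewrite -avgD; congr avg; apply/funext => n.
  rewrite -RintD; last by apply: bdd_measM => //; exact: bdd_meas_comp b2 (measurable_iter_diag mT n).
    by apply: eq_Rintegral => x _; rewrite mulrDr.
  by apply: bdd_measM => //; exact: bdd_meas_comp b1 (measurable_iter_diag mT n).
- have b1 := prodsum_bdd p1.
  rewrite RintZ// mulrCA; have := cvg_diffZ c ih1.
  congr (cvg_diff _ _); apply/funext => M; apply/funext => N.
  rewrite -avgZ; congr avg; apply/funext => n.
  rewrite -RintZ; last by apply: bdd_measM => //; exact: bdd_meas_comp b1 (measurable_iter_diag mT n).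
  by apply: eq_Rintegral => x _; rewrite mulrCA.
Qed.

Definition unif_approx (F : Y -> R) := forall e, 0 < e ->
  exists2 H, prodsum H & forall x, `|F x - H x| <= e.

Lemma Rint_diag (f0 : X -> R) (F : Y -> R) : bdd_meas f0 -> bdd_meas F ->
  (forall x, F (S x) = F x) -> unif_approx F ->
  \int[mu]_x (f0 x * F (diag x)) = (\int[mu]_x f0 x) * \int[nu]_y F y.
Proof.
move=> b0 bF FS aF; have [M0 M00 f0M] := bdd_meas_bound b0.
apply/eqP; rewrite -subr_eq0 -normr_le0; apply/ler_addgt0Pr => e e0; rewrite add0r.
have c0 : 0 < 2 * M0 + 1 by rewrite ltr_wpDl// mulr_ge0// ltW.
(* Replacing F by H costs M0 e1 on the diagonal and M0 e1 in the mean, and the convergence costs e1;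
   together this is e. *)
set e1 := e / (2 * M0 + 1); have e10 : 0 < e1 by rewrite divr_gt0.
have [H p FH] := aF _ e10; have bH := prodsum_bdd p.
have FSn n x : F (iter n S x) = F x by elim: n => //= n ih; rewrite FS.
have [L hL] := weak_prodsum b0 p e10.
have := hL 0%N L.+1 (ltn0Sn _); rewrite subn0 leqnSn => /(_ isT).
set a := avg _ _ _ => h1.
have bD := measurable_diag (k := k) (X := X).
have bI n := measurable_iter_diag mT n.
have h2 : `|a - \int[mu]_x (f0 x * F (diag x))| <= M0 * e1.
  rewrite -[X in _ - X](@avg_cst _ 0 L.+1)// -avgB; apply: norm_avg_le => // n _.
  have bn : bdd_meas (fun x => H (iter n S (diag x))) := bdd_meas_comp bH (bI n).
  rewrite -RintB; [|exact: bdd_measM|exact: bdd_measM b0 (bdd_meas_comp bF bD)].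
  apply: norm_Rint_le.
    by apply: bdd_measB; [exact: bdd_measM|exact: bdd_measM b0 (bdd_meas_comp bF bD)].
  by move=> x; rewrite -mulrBr normrM ler_pM// distrC -(FSn n).
have h3 : `|(\int[mu]_x f0 x) * \int[nu]_y H y - (\int[mu]_x f0 x) * \int[nu]_y F y|
    <= M0 * e1.
  rewrite -mulrBr normrM ler_pM//; first exact: norm_Rint_le.
  rewrite -RintB//; apply: norm_Rint_le; first exact: bdd_measB.
  by move=> x; rewrite distrC.
have -> : e = M0 * e1 + e1 + M0 * e1 by rewrite /e1; field; rewrite gt_eqF.
move: h1 h2 h3; rewrite ltr_norml !ler_norml => /andP[? ?] /andP[? ?] /andP[? ?].
by apply/andP; split; lra.
Qed.

Lemma unif_approx_sqr (F : Y -> R) : bdd_meas F -> unif_approx F ->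
  unif_approx (fun x => F x ^+ 2).
Proof.
move=> bF aF e e0; have [M M0 FM] := bdd_meas_bound bF.
have c0 : 0 < 2 * M + 1 by rewrite ltr_wpDl// mulr_ge0// ltW.
set e1 := Num.min 1 (e / (2 * M + 1)).
have e10 : 0 < e1 by rewrite lt_min ltr01 divr_gt0.
have [H p FH] := aF _ e10; exists (fun x => H x * H x); first exact: prodsumM.
move=> x; have -> : F x ^+ 2 - H x * H x = (F x - H x) * (2 * F x - (F x - H x)) by ring.
rewrite normrM.
have h : `|2 * F x - (F x - H x)| <= 2 * M + 1.
  rewrite (le_trans (ler_normB _ _))// lerD//; last first.
    by rewrite (le_trans (FH x))// ge_min lexx.
  by rewrite normrM ger0_norm// ler_wpM2l.
apply: (@le_trans _ _ (e / (2 * M + 1) * (2 * M + 1))).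
  by rewrite ler_pM// (le_trans (FH x))// ge_min lexx orbT.
by rewrite divfK// gt_eqF.
Qed.

(* [F] is determined on the diagonal, where it equals its mean; applying this to
   [F] and to [F ^+ 2] shows that [F] has zero variance. *)
Lemma invariant_variance (F : Y -> R) : bdd_meas F ->
  (forall x, F (S x) = F x) -> unif_approx F ->
  \int[nu]_y F y ^+ 2 = (\int[nu]_y F y) ^+ 2.
Proof.
move=> bF FS aF.
have bD := measurable_diag (k := k) (X := X).
have bFd : bdd_meas (fun x => F (diag x)) := bdd_meas_comp bF bD.
have b1 : bdd_meas (fun _ : X => 1 : R) := bdd_meas_cst _.
have h1 := Rint_diag b1 bF FS aF.
(* Here f0 is F on the diagonal: the integral of its square is its mean times int F, while [h3]
   evaluates the same integral as int F^2. *)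
have h2 := Rint_diag bFd bF FS aF.
have FS2 x : F (S x) ^+ 2 = F x ^+ 2 by rewrite FS.
have h3 := Rint_diag b1 (bdd_measX 2 bF) FS2 (unif_approx_sqr bF aF).
move: h1 h3; rewrite Rint_cst !mul1r.
under eq_Rintegral do rewrite mul1r.
under [X in _ -> X = _ -> _]eq_Rintegral do rewrite mul1r expr2.
by rewrite h2 => -> <-; rewrite expr2.
Qed.

(** Induction on the number n of coordinates still to be smoothed, the first k - n being already
    under uniform control. [smooth_null] carries the conclusion back from the smoothed function to
    K. *)
Lemma invariant_null (n : nat) (K : Y -> R) : (n <= k)%N -> bdd_meas K ->
  (forall x, K (S x) = K x) -> \int[nu]_y K y = 0 ->
  approx_upto nu (k - n) K -> \int[nu]_y K y ^+ 2 = 0.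
Proof.
elim: n K => [|n ih] K nk bK KS K0 aK.
  rewrite invariant_variance//; first by rewrite K0 expr0n.
  move=> e /aK[H p h]; exists H => // x.
  have := h x; rewrite subn0.
  by under eq_Rintegral do rewrite merge_all; rewrite Rint_cst.
have jk : (k - n.+1 < k)%N by rewrite ltn_subrL (leq_trans _ nk).
pose j := Ordinal jk.
have bC := bdd_meas_corr mu_ nu j bK.
apply: (smooth_null hnu (j := j) bK); apply: ih.
- exact: ltnW.
- exact: bdd_meas_smooth.
- exact: (smooth_inv hnu j bK mT iT KS).
- rewrite (Rint_smooth hnu j bK).
  (* The mean of the smoothed function is int K(y) psi(y_j). As psi is T_j-invariant and a function
     of one coordinate is a product function, [invariant_variance] makes it almost everywhere
     constant, and the integral is a multiple of int K = 0. *)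
  pose psi (t : X) := \int[nu]_x corr nu j K (tnth x j, t).
  have bpsi : bdd_meas psi.
    have b : bdd_meas (fun z : Y * X => corr nu j K (tnth z.1 j, z.2)).
      apply: (bdd_meas_comp bC); apply: measurable_fun_pair => //.
      exact: measurable_tnth_comp.
    exact: (bdd_meas_Rint1 nu (mu_ j) b).
  have psiT t : psi (T j t) = psi t.
    rewrite /psi -(Rint_tuple_map hnu mT iT) /=; last first.
      apply: (bdd_meas_comp bC); apply: measurable_fun_pair.
        exact: measurable_tnth_comp.
      exact: measurable_cst.
    by apply: eq_Rintegral => x _; rewrite tnth_mktuple (corr_inv hnu j bK mT iT KS).
  pose F (y : Y) := psi (tnth y j).
  have pF : prodsum F by exact: prodsum_tnth.
  have bF := prodsum_bdd pF.
  have vF : \int[nu]_y F y ^+ 2 = (\int[nu]_y F y) ^+ 2.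
    have FS x : F (S x) = F x by rewrite /F tnth_mktuple psiT.
    have aF : unif_approx F.
      by move=> e e0; exists F => [|x]; [exact: pF|rewrite subrr normr0 ltW].
    exact: invariant_variance bF FS aF.
  set c := \int[nu]_y F y in vF.
  have F0 : \int[nu]_y (F y - c) ^+ 2 = 0.
    rewrite (_ : (fun y => _) = fun y => F y ^+ 2 + ((- 2 * c) * F y + c ^+ 2)).
      have bcF : bdd_meas (fun y => (- 2 * c) * F y) by exact: bdd_measZ.
      have bcc : bdd_meas (fun _ : Y => c ^+ 2) by exact: bdd_meas_cst.
      rewrite (RintD nu (bdd_measX 2 bF) (bdd_measD bcF bcc)) (RintD nu bcF bcc).
      rewrite (RintZ nu (- 2 * c) bF) Rint_cst vF -/c.
      by ring.
    by apply/funext => y; ring.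
  have bFc : bdd_meas (fun y => F y - c) := bdd_measB bF (bdd_meas_cst c).
  have := Rint_null_mul bFc bK F0.
  rewrite (_ : (fun y => (F y - c) * K y) = fun y => K y * F y - c * K y); last first.
    by apply/funext => y; ring.
  rewrite RintB; [|exact: bdd_measM|exact: bdd_measZ].
  by rewrite RintZ// K0 mulr0 subr0.
- have -> : (k - n = (k - n.+1).+1)%N by rewrite subnSK.
  exact: (approx_uptoS hnu (j := j) bC bK).
Qed.

Lemma weak_ergodic : ergodic_wrt nu S.
Proof.
move=> B mB SB.
pose b := fine (nu B).
have bE : nu B = b%:E by rewrite fineK// fin_num_measure.
pose K (x : Y) := \1_B x - b.
have bI : bdd_meas (\1_B : Y -> R) by exact: bdd_meas_indic.
have bK : bdd_meas K by apply: bdd_measB => //; exact: bdd_meas_cst.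
have K0 : \int[nu]_y K y ^+ 2 = 0.
  apply: (@invariant_null k) => //.
  - move=> x; rewrite /K; congr (_ - _).
    rewrite !indicE; congr (_%:R); congr nat_of_bool.
    by rewrite -[in RHS]SB; apply/idP/idP => /set_mem h; apply/mem_set.
  - rewrite /K RintB//; last exact: bdd_meas_cst.
    by rewrite Rint_indic// Rint_cst /b subrr.
  - by rewrite subnn; exact: approx_upto0.
(* The variance of the indicator of a set of measure b. *)
have : b - b ^+ 2 = 0.
  rewrite -K0 /K (_ : (fun y => _) = fun y => (1 - 2 * b) * \1_B y + b ^+ 2).
    have bcc : bdd_meas (fun _ : Y => b ^+ 2) by exact: bdd_meas_cst.
    rewrite (RintD nu (bdd_measZ _ bI) bcc) RintZ// Rint_cst Rint_indic// -/b.
    by ring.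
  apply/funext => y; rewrite indicE; case: (y \in B) => /=; ring.
move=> /eqP; rewrite expr2 -{1}[b]mulr1 -mulrBr mulf_eq0 subr_eq0.
move=> /orP[/eqP b0|/eqP b1]; [left|right]; apply: (eq_trans bE).
  by rewrite b0.
by rewrite -b1.
Qed.

End WeakToErgodic.

(** * The mean ergodic theorem for an ergodic transformation *)

Section MeanErgodic.
Context {R : realType} {d : measure_display} {Y : measurableType d}.
Variables (nu : probability Y R) (S : Y -> Y).
Hypothesis mS : measurable_fun setT S.
Hypothesis iS : forall A, measurable A -> nu (S @^-1` A) = nu A.
Hypothesis eS : forall A, measurable A -> S @^-1` A = A ->
  nu A = 0%E \/ nu A = 1%E.
Implicit Types f g : Y -> R.

Definition bsum g n x : R := \sum_(0 <= i < n) g (iter i S x).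

Lemma bsum0 g x : bsum g 0 x = 0.
Proof. by rewrite /bsum big_geq. Qed.

Lemma bsumS g n x : bsum g n.+1 x = g x + bsum g n (S x).
Proof.
rewrite /bsum big_nat_recl//; congr (_ + _).
by apply: eq_bigr => i _; rewrite iterSr.
Qed.

Lemma bdd_meas_bsum g n : bdd_meas g -> bdd_meas (bsum g n).
Proof.
move=> bg; apply: bdd_meas_sum => i.
exact: bdd_meas_comp bg (measurable_iter i mS).
Qed.

(* the maximum of [bsum g j x] over [j <= n] *)
Fixpoint maxsum g n x : R :=
  if n is m.+1 then Num.max 0 (g x + maxsum g m (S x)) else 0.

Lemma maxsum_ge0 g n x : 0 <= maxsum g n x.
Proof. by case: n => //= n; rewrite le_max lexx. Qed.

Lemma maxsum_ndS g n x : maxsum g n x <= maxsum g n.+1 x.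
Proof.
elim: n x => [|n ih] x; first by rewrite maxsum_ge0.
rewrite /= ge_max le_max lexx /= le_max lerD2l; apply/orP; right; exact: ih.
Qed.

Lemma bsum_maxsum g n x : bsum g n x <= maxsum g n x.
Proof.
elim: n x => [|n ih] x; first by rewrite bsum0.
by rewrite bsumS /= le_max lerD2l ih orbT.
Qed.

Lemma bdd_meas_maxsum g n : bdd_meas g -> bdd_meas (maxsum g n).
Proof.
move=> bg; elim: n => [|n ih]; first exact: bdd_meas_cst.
have b : bdd_meas (fun x => g x + maxsum g n (S x)).
  by apply: bdd_measD => //; exact: bdd_meas_comp ih mS.
split.
  by apply: measurable_maxr; [exact: measurable_cst|case: b].
have [M M0 bM] := bdd_meas_bound b; exists M => x /=.
by rewrite ger0_norm ?le_max ?lexx// ge_max ltW//= (le_trans (ler_norm _)).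
Qed.

Lemma measurable_gt (h : Y -> R) c : measurable_fun setT h ->
  measurable [set x | c < h x].
Proof.
move=> mh; have := mh measurableT `]c, +oo[%classic (measurable_itv _).
rewrite setTI; congr measurable; apply/seteqP; split=> x /=;
  by rewrite in_itv /= andbT.
Qed.

Lemma measurable_bsum_gt g c : bdd_meas g ->
  measurable [set x | exists n, c < bsum g n x].
Proof.
move=> bg; rewrite (_ : [set x | _] = \bigcup_n [set x | c < bsum g n x]).
  apply: bigcupT_measurable => n; apply: measurable_gt.
  by have [] := bdd_meas_bsum n bg.
by apply/seteqP; split=> x /= [n]; exists n.
Qed.

(** Garsia's argument. Write F for [maxsum g n]. Where F > 0 the recursion gives F <= g + F o S,
    elsewhere F = 0 <= F o S; so F - F o S, whose integral is 0, lies below g times the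
    indicator. *)
Lemma Rint_maxsum_ge0 g n : bdd_meas g ->
  0 <= \int[nu]_x (g x * \1_[set x | 0 < maxsum g n x] x).
Proof.
move=> bg; have bF := bdd_meas_maxsum n bg.
have bFS : bdd_meas (fun x => maxsum g n (S x)) := bdd_meas_comp bF mS.
have mE : measurable [set x | 0 < maxsum g n x] by apply: measurable_gt; case: bF.
apply: (@le_trans _ _ (\int[nu]_x (maxsum g n x - maxsum g n (S x)))).
  by rewrite RintB// (Rint_comp mS iS bF) subrr.
apply: le_Rint; first exact: bdd_measB.
  by apply: bdd_measM => //; exact: bdd_meas_indic.
move=> x; rewrite indicE; case: (boolP (x \in _)) => [/set_mem /= F0|/negP nF].
  rewrite mulr1 lerBlDr; case: n F0 {bF bFS mE} => [|n]; first by rewrite ltxx.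
  move=> /= /[dup]; rewrite {1}lt_max ltxx /= => /ltW/max_idPr -> _.
  by rewrite lerD2l; exact: maxsum_ndS.
rewrite mulr0 subr_le0; apply: le_trans (maxsum_ge0 _ _ _).
by rewrite leNgt; apply/negP => F0; apply: nF; exact: mem_set.
Qed.

(** The sets where the maximum up to n is positive increase to a set of full measure, and
    boundedness of g takes care of the small complement. *)
Lemma maximal_ergodic g : bdd_meas g ->
  nu [set x | exists n, 0 < bsum g n x] = 1%E -> 0 <= \int[nu]_x g x.
Proof.
move=> bg nE.
pose E n := [set x | 0 < maxsum g n x].
have mE n : measurable (E n).
  by apply: measurable_gt; have [] := bdd_meas_maxsum n bg.
have ndE : nondecreasing_seq E.
  apply/nondecreasing_seqP => n; apply/subsetPset => x /= h.
  exact: lt_le_trans h (maxsum_ndS _ _ _).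
have mU : measurable (\bigcup_n E n) by exact: bigcupT_measurable.
have nU : nu (\bigcup_n E n) = 1%E.
  apply/eqP; rewrite eq_le probability_le1//=.
  apply: (@le_trans _ _ (nu [set x | exists n, 0 < bsum g n x])).
    by rewrite nE.
  apply: le_measure; rewrite ?inE//; first exact: measurable_bsum_gt.
  move=> x [n h]; exists n => //; exact: lt_le_trans h (bsum_maxsum _ _ _).
have : (fun n => nu (E n)) @ \oo --> (1%:R)%:E.
  by rewrite -nU; exact: nondecreasing_cvg_mu mE mU ndE.
move=> /fine_cvgP[_ cv].
have [M M0 gM] := bdd_meas_bound bg.
rewrite leNgt; apply/negP => g0.
(* A complement of this measure costs at most -(int g) / 2, so int g >= (int g) / 2, against int g <
   0. *)
have e0 : 0 < - (\int[nu]_x g x) / (2 * M) by rewrite divr_gt0 ?oppr_gt0 ?mulr_gt0.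
have /cvgrPdist_le/(_ _ e0)[n _ /(_ n (leqnn n)) /= hn] := cv.
have bI : bdd_meas (\1_(E n) : Y -> R) by exact: bdd_meas_indic.
have b1I : bdd_meas (fun x => 1 - \1_(E n) x : R).
  by apply: bdd_measB => //; exact: bdd_meas_cst.
have h1 := Rint_maxsum_ge0 n bg.
have h2 : \int[nu]_x (g x * \1_(E n) x) - M * (1 - fine (nu (E n))) <= \int[nu]_x g x.
  rewrite -Rint_indic// -[X in X - \int[_]_x _](Rint_cst nu) -RintB//; last exact: bdd_meas_cst.
  rewrite -RintZ// -RintB; [|exact: bdd_measM|exact: bdd_measZ].
  apply: le_Rint => //.
    by apply: bdd_measB; [exact: bdd_measM|exact: bdd_measZ].
  move=> x; have := gM x; rewrite ler_norml => /andP[? ?]; rewrite indicE.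
  by case: (_ \in _); rewrite /=; lra.
have : M * (1 - fine (nu (E n))) <= M * (- (\int[nu]_x g x) / (2 * M)).
  by rewrite ler_wpM2l ?(ltW M0)// (le_trans (ler_norm _)).
have -> : M * (- (\int[nu]_x g x) / (2 * M)) = - (\int[nu]_x g x) / 2.
  by field; rewrite gt_eqF.
rewrite -/(E n) in h1; move: h1 h2 g0.
set I := \int[nu]_x g x; set I' := \int[nu]_x _; set p := M * _.
lra.
Qed.

(* The set where the Birkhoff sums are unbounded above is strictly invariant,
   hence null or of full measure; the latter contradicts the maximal inequality. *)
Lemma bsum_bounded g e : bdd_meas g -> \int[nu]_x g x < 0 -> 0 < e ->
  exists C : nat, fine (nu [set x | exists n, C%:R < bsum g n x]) <= e.
Proof.
move=> bg g0 e0.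
pose D (C : nat) := [set x | exists n, C%:R < bsum g n x].
have mD C : measurable (D C) by exact: measurable_bsum_gt.
have niD : nonincreasing_seq D.
  apply/nonincreasing_seqP => C; apply/subsetPset => x [n h]; exists n.
  by apply: le_lt_trans h; rewrite ler_nat.
have mB : measurable (\bigcap_C D C) by exact: bigcapT_measurable.
(* Up to an index shift, sums along x and along S x differ by g x, at most c in absolute value;
   starting from the level C + c gives both inclusions. In the second one the empty sum is excluded,
   not being above C + c. *)
have SB : S @^-1` (\bigcap_C D C) = \bigcap_C D C.
  have [M M0 gM] := bdd_meas_bound bg.
  have [c Mc] : exists c : nat, M <= c%:R.
    by exists (Num.truncn M).+1; rewrite ltW// truncnS_gt.
  apply/seteqP; split=> x /= h C _.
    have [n hn] := h (C + c)%N I; exists n.+1; rewrite bsumS.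
    have := gM x; rewrite ler_norml => /andP[? ?].
    by move: hn; rewrite natrD; lra.
  have [[|n] hn] := h (C + c)%N I.
    by move: hn; rewrite bsum0 ltNge ler0n.
  exists n; move: hn; rewrite bsumS natrD.
  by have := gM x; rewrite ler_norml => /andP[? ?]; lra.
have B0 : nu (\bigcap_C D C) = 0%E.
  have [//|B1] := eS mB SB.
  have : 0 <= \int[nu]_x g x.
    apply: maximal_ergodic => //; apply/eqP; rewrite eq_le probability_le1/=.
      rewrite -B1; apply: le_measure; rewrite ?inE//.
        by have := mD 0%N; rewrite /D.
      by move=> x /(_ 0%N I).
    by have := mD 0%N; rewrite /D.
  by rewrite leNgt g0.
have D0oo : (nu (D 0%N) < +oo)%E.
  by rewrite (le_lt_trans (probability_le1 _ (mD _)))// ltry.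
have B0E : nu (\bigcap_C D C) = (0 : R)%:E by exact: B0.
have : (fun C => nu (D C)) @ \oo --> (0 : R)%:E.
  by rewrite -B0E; exact: nonincreasing_cvg_mu D0oo mD mB niD.
move=> /fine_cvgP[_ /cvgrPdist_le/(_ _ e0)[C _ /(_ C (leqnn C)) /=]].
rewrite sub0r normrN => h; exists C; exact: le_trans (ler_norm _) h.
Qed.

Lemma bsumB f c m x : bsum (fun y => f y - c) m x = bsum f m x - c * m%:R.
Proof. by rewrite /bsum sumrB sumr_const_nat subn0 mulr_natr. Qed.

(** Both f - c - a and -f + c - a have mean -a < 0, so off a small set their sums stay below
    constants C1 and C2; once a m >= C1 + C2, the average is within 2 a of c. A single m is enough
    for the domination argument. *)
Lemma mean_ergodic f e : bdd_meas f -> 0 < e ->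
  exists2 m, (0 < m)%N &
    \int[nu]_x (avg 0 m (fun n => f (iter n S x)) - \int[nu]_y f y) ^+ 2 <= e.
Proof.
move=> bf e0; set c := \int[nu]_y f y.
have [M M0 fM] := bdd_meas_bound bf.
(* Off the exceptional sets the square is at most 4 a^2 <= e / 2; on them it is at most 4 M^2, and
   their measures add up to at most 2 [del], which contributes e / 2. *)
pose a := Num.min 1 (e / 8).
have a0 : 0 < a by rewrite lt_min ltr01 divr_gt0.
pose del := e / (16 * M ^+ 2).
have M20 : 0 < M ^+ 2 by rewrite exprn_gt0.
have del0 : 0 < del by rewrite divr_gt0// mulr_gt0.
have cM : `|c| <= M by exact: norm_Rint_le.
pose g1 y := f y - (c + a); pose g2 y := - f y - (- c + a).
have bNf : bdd_meas (fun y => - f y).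
  by under eq_fun do rewrite -mulN1r; exact: bdd_measZ.
have bg1 : bdd_meas g1 by apply: bdd_measB => //; exact: bdd_meas_cst.
have bg2 : bdd_meas g2 by apply: bdd_measB => //; exact: bdd_meas_cst.
have Ig1 : \int[nu]_x g1 x < 0.
  by rewrite RintB// ?Rint_cst -/c; [lra|exact: bdd_meas_cst].
have Ig2 : \int[nu]_x g2 x < 0.
  rewrite RintB// ?Rint_cst; last exact: bdd_meas_cst.
  under eq_Rintegral do rewrite -mulN1r.
  by rewrite RintZ// -/c; lra.
have [C1 h1] := bsum_bounded bg1 Ig1 del0.
have [C2 h2] := bsum_bounded bg2 Ig2 del0.
pose D1 := [set x | exists n, C1%:R < bsum g1 n x].
pose D2 := [set x | exists n, C2%:R < bsum g2 n x].
have mD1 : measurable D1 by exact: measurable_bsum_gt.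
have mD2 : measurable D2 by exact: measurable_bsum_gt.
have bD1 : bdd_meas (\1_D1 : Y -> R) by exact: bdd_meas_indic.
have bD2 : bdd_meas (\1_D2 : Y -> R) by exact: bdd_meas_indic.
pose m := (Num.truncn ((C1 + C2)%:R / a)).+1.
have ma : (C1 + C2)%:R <= a * m%:R.
  by rewrite mulrC -ler_pdivrMr// ltW// truncnS_gt.
have m0 : 0 < m%:R :> R by rewrite ltr0n.
exists m => //.
pose A x := avg 0 m (fun n => f (iter n S x)).
have AE x : A x = m%:R^-1 * bsum f m x by rewrite /A /avg subn0.
have bA : bdd_meas A.
  by rewrite (funext AE); apply: bdd_measZ; exact: bdd_meas_bsum.
have AM x : `|A x| <= M by apply: norm_avg_le => // n _.
have bS : bdd_meas (fun x => 4 * M ^+ 2 * (\1_D1 x + \1_D2 x)).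
  by apply: bdd_measZ; exact: bdd_measD.
have b4 : bdd_meas (fun _ : Y => 4 * a ^+ 2) by exact: bdd_meas_cst.
apply: (@le_trans _ _ (\int[nu]_x (4 * a ^+ 2 + 4 * M ^+ 2 * (\1_D1 x + \1_D2 x)))).
  apply: le_Rint.
  - by apply: bdd_measX; apply: bdd_measB => //; exact: bdd_meas_cst.
  - exact: bdd_measD.
  - move=> x; rewrite -/(A x).
    have big : (A x - c) ^+ 2 <= 4 * M ^+ 2.
      have -> : 4 * M ^+ 2 = (2 * M) ^+ 2 by ring.
      rewrite -[leLHS](real_normK (num_real _)) lerXn2r ?nnegrE ?mulr_ge0 ?(ltW M0)//.
      rewrite (le_trans (ler_normB _ _))// mulr2n mulrDl mul1r lerD//.
    have p1 : 0 <= 4 * M ^+ 2 by rewrite mulr_ge0// ltW.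
    have p2 : 0 <= 4 * a ^+ 2 by rewrite mulr_ge0// sqr_ge0.
    rewrite !indicE; case: (boolP (x \in D1)) => [_|/negP x1].
      by case: (x \in D2) => /=; lra.
    case: (boolP (x \in D2)) => [_|/negP x2]; first by rewrite /=; lra.
    rewrite /= addr0 mulr0 addr0.
    have l1 : bsum g1 m x <= C1%:R.
      by rewrite leNgt; apply/negP => l; apply: x1; apply: mem_set; exists m.
    have l2 : bsum g2 m x <= C2%:R.
      by rewrite leNgt; apply/negP => l; apply: x2; apply: mem_set; exists m.
    have N2 : bsum (fun y => - f y) m x = - bsum f m x by rewrite /bsum sumrN.
    rewrite !bsumB N2 in l1 l2.
    have Sm : bsum f m x = A x * m%:R by rewrite AE; field; rewrite gt_eqF.
    rewrite Sm in l1 l2; rewrite natrD in ma.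
    have C10 := ler0n R C1; have C20 := ler0n R C2.
    have u1 : A x - c <= 2 * a.
      by rewrite -(ler_pM2r m0); lra.
    have u2 : - (2 * a) <= A x - c.
      by rewrite -(ler_pM2r m0); lra.
    have -> : 4 * a ^+ 2 = (2 * a) ^+ 2 by ring.
    rewrite -[leLHS](real_normK (num_real _)) lerXn2r ?nnegrE ?mulr_ge0 ?(ltW a0)//.
    by rewrite ler_norml u1 u2.
rewrite (RintD nu b4 bS) Rint_cst RintZ; last exact: bdd_measD.
rewrite RintD// !Rint_indic//.
rewrite -/D1 in h1; rewrite -/D2 in h2.
have h3 : 4 * M ^+ 2 * (fine (nu D1) + fine (nu D2)) <= 4 * M ^+ 2 * (del + del).
  by apply: ler_wpM2l; [rewrite mulr_ge0 ?(ltW M20)|exact: lerD].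
have h4 : 4 * M ^+ 2 * (del + del) = e / 2.
  by rewrite /del; field; rewrite gt_eqF.
have a1 : a <= 1 by rewrite ge_min lexx.
have ae : a <= e / 8 by rewrite ge_min lexx orbT.
have h5 : a ^+ 2 <= a * 1 by rewrite expr2 ler_wpM2l ?(ltW a0).
lra.
Qed.

End MeanErgodic.

(** * Existence of product measures *)

Section ProductMeasureExists.
Context {R : realType} {d : measure_display} {X : measurableType d}.

(** [product_ergodic] quantifies over all product measures; this supplies one. Induction on k
    through the cons map, from the Dirac mass at the empty tuple. *)
Lemma product_measure_exists k (mu_ : 'I_k -> probability X R) :
  exists nu : probability (k.-tuple X) R, is_product_measure (fun i => mu_ i) nu.
Proof.
elim: k mu_ => [|k ih] mu_.
  exists (\d_([tuple] : 0.-tuple X)) => A mA.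
  rewrite big_ord0 (_ : [set x | _] = setT); first exact: diracT.
  by apply/seteqP; split=> // x _ [].
have [nu hnu] := ih (fun i => mu_ (lift ord0 i)).
pose phi (z : X * k.-tuple X) := [the k.+1.-tuple X of z.1 :: z.2].
have mphi : measurable_fun setT phi by exact: measurable_cons.
pose mphi_ := isMeasurableFun.Build _ _ _ _ _ mphi.
pose phiRV : {mfun (X * k.-tuple X)%type >-> k.+1.-tuple X} := HB.pack phi mphi_.
exists (distribution (prob_prod (mu_ ord0) nu) phiRV) => A mA.
transitivity (prob_prod (mu_ ord0) nu
    (A ord0 `*` rect (fun i : 'I_k => A (lift ord0 i)))).
  congr (prob_prod (mu_ ord0) nu _); apply/seteqP; split=> -[s y] /=.
    move=> h; split=> [|i]; first by have := h ord0.
    by have := h (lift ord0 i); rewrite /phi /= tnthS.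
  move=> [h0 h] i; rewrite /phi /=.
  by case: (unliftP ord0 i) => [j ->|->//]; rewrite tnthS; exact: h.
rewrite prob_prodE//; last exact: measurable_rect.
rewrite [X in (_ * X)%E]hnu// big_ord_recl EFinM; congr (_ * _)%E.
by rewrite fineK// fin_num_measure.
Qed.

End ProductMeasureExists.

(** * Mean convergence from ergodicity and domination *)

Section Domination.
Context {R : realType} {d : measure_display} {X : measurableType d} {k : nat}.
Local Notation Y := (k.-tuple X).
Variables (mu : probability X R) (mu_ : 'I_k -> probability X R).
Variable nu : probability Y R.
Hypothesis hnu : is_product_measure (fun i => mu_ i) nu.
Variable T : 'I_k -> X -> X.
Hypothesis mT : forall i, measurable_fun setT (T i).
Hypothesis iT : forall i, invariant_measure (T i) (mu_ i).
Local Notation S := (tuple_map T).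
Hypothesis eS : ergodic_wrt nu S.
Variable C : R.
Hypothesis C0 : 0 < C.

(** The bound of (iv)(b) in epsilon form, with a function G in place of the indicator of a
    rectangle. *)
Definition dominated (G : Y -> R) : Prop := forall e, 0 < e ->
  exists L : nat, forall M N : nat, (M < N)%N -> (L <= N - M)%N ->
    avg M N (fun n => \int[mu]_x G (iter n S (diag x))) <= C * \int[nu]_y G y + e.

Hypothesis dominated_rect : forall A : 'I_k -> set X,
  (forall i, measurable (A i)) -> dominated (\1_(rect A)).

Let bdd_iter (G : Y -> R) n : bdd_meas G -> bdd_meas (fun x => G (iter n S (diag x))).
Proof. by move=> bG; exact: bdd_meas_comp bG (measurable_iter_diag mT n). Qed.

(** A one-sided bound is preserved by non-negative coefficients only. *)
Lemma dominated_combination (I : Type) (r : seq I) (c : I -> R) (A : I -> 'I_k -> set X) :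
  (forall w, 0 <= c w) -> (forall w i, measurable (A w i)) ->
  dominated (fun y => \sum_(w <- r) c w * \1_(rect (A w)) y).
Proof.
move=> c0 mA.
have bI w : bdd_meas (\1_(rect (A w)) : Y -> R).
  by apply: bdd_meas_indic; exact: measurable_rect.
elim: r => [|w r ih] e e0.
  exists 0%N => M N MN _; under eq_fun do under eq_Rintegral do rewrite big_nil.
  under [\int[nu]_y _]eq_Rintegral do rewrite big_nil.
  by rewrite !Rint_cst avg_cst// mulr0 add0r ltW.
have w0 : 0 < c w + 1 by rewrite ltr_wpDl.
have e20 : 0 < e / 2 by rewrite divr_gt0.
have [L1 h1] := dominated_rect (mA w) (divr_gt0 e20 w0).
have [L2 h2] := ih _ e20.
exists (maxn L1 L2) => M N MN; rewrite geq_max => /andP[l1 l2].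
have {}h1 := h1 M N MN l1; have {}h2 := h2 M N MN l2.
have bs : bdd_meas (fun y => \sum_(j <- r) c j * \1_(rect (A j)) y).
  by apply: bdd_meas_sum => j; exact: bdd_measZ.
rewrite (_ : (fun n => _) = fun n =>
    c w * \int[mu]_x \1_(rect (A w)) (iter n S (diag x)) +
    \int[mu]_x \sum_(j <- r) c j * \1_(rect (A j)) (iter n S (diag x))); last first.
  apply/funext => n; rewrite -RintZ; last exact: bdd_iter (bI w).
  rewrite -RintD; [|exact: bdd_measZ (bdd_iter _ (bI w))|exact: bdd_iter bs].
  by apply: eq_Rintegral => x _; rewrite big_cons.
under [\int[nu]_y _]eq_Rintegral do rewrite big_cons.
rewrite (RintD nu (bdd_measZ (c w) (bI w)) bs) (RintZ nu (c w) (bI w)).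
rewrite avgD avgZ.
have h3 : c w * avg M N (fun n => \int[mu]_x \1_(rect (A w)) (iter n S (diag x))) <=
    c w * (C * \int[nu]_y \1_(rect (A w)) y) + e / 2.
  apply: le_trans (ler_wpM2l (c0 w) h1) _; rewrite mulrDr lerD2l.
  by rewrite mulrCA ler_piMr ?(ltW e20)// ler_pdivrMr// mul1r lerDl.
by move: h2 h3; lra.
Qed.

Lemma dominated_closed (G : Y -> R) : bdd_meas G ->
  (forall e, 0 < e -> exists G', [/\ bdd_meas G', dominated G' &
    forall y, `|G y - G' y| <= e]) -> dominated G.
Proof.
move=> bG aG e e0.
have e30 : 0 < e / 2 by rewrite divr_gt0.
have C1 : 0 < C + 1 by rewrite ltr_wpDl// ltW.
(* The uniform error enters once in the averages and C times in the bound, e / 2 in total; the other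
   half is for [dG']. *)
have [G' [bG' dG' GG']] := aG _ (divr_gt0 e30 C1).
have [L hL] := dG' _ e30.
exists L => M N MN LMN; have {hL} h1 := hL M N MN LMN.
set t := e / 2 / (C + 1) in GG'.
have h2 : avg M N (fun n => \int[mu]_x G (iter n S (diag x))) <=
    avg M N (fun n => \int[mu]_x G' (iter n S (diag x))) + t.
  rewrite -(avg_cst t MN) -avgD; apply: le_avg => n _.
  rewrite -lerBlDl -RintB; try exact: bdd_iter.
  apply: le_trans (ler_norm _) _; apply: norm_Rint_le.
    by apply: bdd_measB; exact: bdd_iter.
  by move=> x; exact: GG'.
have h3 : \int[nu]_y G' y <= \int[nu]_y G y + t.
  rewrite -lerBlDl -RintB//; apply: le_trans (ler_norm _) _.
  by apply: norm_Rint_le => [|y]; [exact: bdd_measB|rewrite distrC].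
have h4 : C * \int[nu]_y G' y <= C * (\int[nu]_y G y + t) by rewrite ler_wpM2l// ltW.
have h5 : t * (C + 1) = e / 2 by rewrite /t divfK// gt_eqF.
move: h1 h2 h4 h5; lra.
Qed.

Section Joint.
Variable f : 'I_k -> X -> R.
Hypothesis bf : forall i, bdd_meas (f i).
Let H (y : Y) := \prod_(i < k) f i (tnth y i).
Let c := \prod_(i < k) \int[mu_ i]_x f i x.
Let bH : bdd_meas H := bdd_meas_prod_tnth bf.

(** With the f_i replaced by functions of finitely many values, the square depends only on the
    labels met by each coordinate in its first m iterates. The points with prescribed labels form a
    rectangle, on which the square is a constant >= 0. *)
Lemma dominated_sqr m : (0 < m)%N ->
  dominated (fun y => (avg 0 m (fun l => H (iter l S y)) - c) ^+ 2).
Proof.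
move=> m0.
have bavg (h : Y -> R) : bdd_meas h -> bdd_meas (fun y => avg 0 m (fun l => h (iter l S y))).
  move=> bh; apply: bdd_measZ; apply: bdd_meas_sum => l.
  exact: bdd_meas_comp bh (measurable_iter l (measurable_tuple_map mT)).
have bsq (h : Y -> R) : bdd_meas h ->
    bdd_meas (fun y => (avg 0 m (fun l => h (iter l S y)) - c) ^+ 2).
  move=> bh; apply: bdd_measX; apply: bdd_measB; first exact: bavg.
  exact: bdd_meas_cst.
apply: dominated_closed => [|e e0]; first exact: bsq.
have [B B0 HB] := bdd_meas_bound bH.
have [M M0 fM] := common_bound bf.
(* The difference of the squares factors as (a - a') (2 a - 2 c - (a - a')), and V bounds the second
   factor when |a - a'| <= 1. *)
pose V := 2 * (B + `|c|) + 1.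
have V0 : 0 < V by rewrite ltr_wpDl// mulr_ge0// addr_ge0// ltW.
pose eta := Num.min 1 (e / V).
have eta0 : 0 < eta by rewrite lt_min ltr01 divr_gt0.
have [del del0 hdel] := prod_unif_cont 'I_k M0 eta0.
have [r [phi [q [mq fq]]]] := discretize bf del0.
pose H' (y : Y) := \prod_(i < k) phi (q i (tnth y i)).
have HH' y : `|H y - H' y| <= eta by apply: hdel => i; [exact: fM|exact: fq].
have bH' : bdd_meas H'.
  have bg i : bdd_meas (fun x => phi (q i x)).
    under eq_fun do rewrite discretize_sum.
    by apply: bdd_meas_sum => a; apply/bdd_measZ/bdd_meas_indic.
  exact: bdd_meas_prod_tnth bg.
exists (fun y => (avg 0 m (fun l => H' (iter l S y)) - c) ^+ 2); split.
- exact: bsq.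
(* The points whose T_i-orbit of length m reads the labels w(i, 0), ..., w(i, m - 1). *)
- pose cell (w : {ffun 'I_k * 'I_m -> 'I_r.+1}) (i : 'I_k) : set X :=
    \bigcap_(l : 'I_m) ((fun x => q i (iter l (T i) x)) @^-1` [set w (i, l)]).
  pose Gam (w : {ffun 'I_k * 'I_m -> 'I_r.+1}) :=
    (m%:R^-1 * \sum_(l < m) \prod_(i < k) phi (w (i, l)) - c) ^+ 2.
  have mcell w i : measurable (cell w i).
    apply: fin_bigcap_measurable => [|l _]; first exact: finite_finset.
    have := measurable_iter l (mT i) measurableT (mq i (w (i, l))).
    by rewrite setTI.
  have Gam0 w : 0 <= Gam w by exact: sqr_ge0.
  have := dominated_combination (index_enum _) Gam0 mcell.
  congr dominated; apply/funext => y.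
  pose wy := [ffun il : 'I_k * 'I_m => q il.1 (iter il.2 (T il.1) (tnth y il.1))].
  rewrite (bigD1 wy)//= big1 ?addr0.
    rewrite indicE mem_set ?mulr1; last by move=> i l _ /=; rewrite ffunE.
    rewrite /Gam /avg subn0 big_mkord; congr ((_ * _ - _) ^+ 2).
    apply: eq_bigr => l _; apply: eq_bigr => i _.
    by rewrite ffunE tnth_iter_tuple_map.
  move=> w wwy; rewrite indicE memNset ?mulr0// => yw.
  move/eqP: wwy; apply; apply/ffunP => -[i l]; rewrite ffunE /=.
  by have := yw i l I.
- move=> y; set a := avg _ _ _; set a' := avg _ _ _.
  have aa' : `|a - a'| <= eta.
    by rewrite -avgB; apply: norm_avg_le => // l _; exact: HH'.
  have aB : `|a| <= B by apply: norm_avg_le.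
  have -> : (a - c) ^+ 2 - (a' - c) ^+ 2 = (a - a') * (2 * a - 2 * c - (a - a')) by ring.
  rewrite normrM.
  have h : `|2 * a - 2 * c - (a - a')| <= V.
    apply: le_trans (ler_normB _ _) _; rewrite lerD//.
      by rewrite -mulrBr normrM ger0_norm// ler_wpM2l// (le_trans (ler_normB _ _))// lerD2r.
    by rewrite (le_trans aa')// ge_min lexx.
  apply: (@le_trans _ _ (e / V * V)); last by rewrite divfK// gt_eqF.
  by rewrite ler_pM// (le_trans aa')// ge_min lexx orbT.
Qed.

Lemma joint_mean_convergence e : 0 < e -> exists L : nat, forall M N : nat,
  (M < N)%N -> (L <= N - M)%N ->
  \int[mu]_x (avg M N (fun n => H (iter n S (diag x))) - c) ^+ 2 <= e.
Proof.
move=> e0.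
have cE : c = \int[nu]_y H y by rewrite (Rint_prod_tnth hnu bf).
have [B B0 HB] := bdd_meas_bound bH.
have inuS := tuple_map_invariant hnu mT iT.
(* After multiplication by C this gives e / 8, the domination error is another e / 8, and the factor
   2 in front makes e / 2; the remaining e / 2 is 2 t^2 with t^2 <= t <= e / 4. *)
have e10 : 0 < e / (8 * C) by rewrite divr_gt0// mulr_gt0.
have [m m0 hm] := mean_ergodic (measurable_tuple_map mT) inuS eS bH e10.
pose A y := avg 0 m (fun l => H (iter l S y)).
rewrite -/(A _) -cE in hm.
have e80 : 0 < e / 8 by rewrite divr_gt0.
have [L1 h1] := dominated_sqr m0 e80.
(* By [avg_shift], s / (N - M) bounds the effect of shifting the window by any l < m. *)
pose s := 2 * B * m%:R.
have s0 : 0 < s by rewrite !mulr_gt0// ltr0n.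
pose t := Num.min 1 (e / 4).
have t0 : 0 < t by rewrite lt_min ltr01 divr_gt0.
pose L2 := (Num.truncn (s / t)).+1.
exists (maxn L1 L2) => M N MN; rewrite geq_max => /andP[l1 l2].
have {h1} h1 := h1 M N MN l1.
have NM0 : 0 < (N - M)%:R :> R by rewrite ltr0n subn_gt0.
have st : s / (N - M)%:R <= t.
  rewrite ler_pdivrMr// mulrC -ler_pdivrMr//; apply: le_trans (ltW (truncnS_gt _)) _.
  by rewrite ler_nat.
have bA : bdd_meas A.
  apply: bdd_measZ; apply: bdd_meas_sum => l.
  exact: bdd_meas_comp bH (measurable_iter l (measurable_tuple_map mT)).
have bG : bdd_meas (fun y => (A y - c) ^+ 2).
  by apply: bdd_measX; apply: bdd_measB => //; exact: bdd_meas_cst.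
have bavg (h : Y -> R) : bdd_meas h ->
    bdd_meas (fun x => avg M N (fun n => h (iter n S (diag x)))).
  by move=> bh; apply: bdd_measZ; apply: bdd_meas_sum => n; exact: bdd_iter.
have bt : bdd_meas (fun _ : X => 2 * t ^+ 2) by exact: bdd_meas_cst.
have b2 := bdd_measZ 2 (bavg _ bG).
apply: (@le_trans _ _ (\int[mu]_x (2 * t ^+ 2 +
    2 * avg M N (fun n => (A (iter n S (diag x)) - c) ^+ 2)))).
  apply: le_Rint.
  - by apply: bdd_measX; apply: bdd_measB; [exact: bavg|exact: bdd_meas_cst].
  - exact: bdd_measD.
  - move=> x; pose u n := H (iter n S (diag x)).
    rewrite -/(u _).
    set a := avg M N _.
    pose b := avg M N (fun n => A (iter n S (diag x))).
    have ab : `|a - b| <= t.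
      apply: le_trans st; rewrite distrC.
      (* Exchanging the two averages turns b into the mean of the averages of u over windows shifted
         by l < m. *)
      have -> : b = avg 0 m (fun l => avg M N (fun n => u (n + l)%N)).
        rewrite -avg_exchange; congr avg; apply/funext => n.
        by congr avg; apply/funext => l; rewrite /u addnC iterD.
      rewrite -(avg_cst a m0) -avgB; apply: norm_avg_le => // l /andP[_ lm].
      apply: le_trans (avg_shift l MN (fun n => HB _)) _.
      rewrite ler_wpM2r ?invr_ge0 ?ler0n// ler_wpM2l ?mulr_ge0 ?(ltW B0)//.
      by rewrite ler_nat ltnW.
    have bc : (b - c) ^+ 2 <= avg M N (fun n => (A (iter n S (diag x)) - c) ^+ 2).
      by rewrite -[X in b - X](avg_cst c MN) -avgB; exact: avg_sqr.
    have ab2 : (a - b) ^+ 2 <= t ^+ 2.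
      by rewrite -[leLHS](real_normK (num_real _)) lerXn2r ?nnegrE ?(ltW t0).
    have sq : 0 <= (a - b - (b - c)) ^+ 2 by exact: sqr_ge0.
    (* The parallelogram identity, giving (a - c)^2 <= 2 (a - b)^2 + 2 (b - c)^2. *)
    have : (a - c) ^+ 2 + (a - b - (b - c)) ^+ 2 = 2 * (a - b) ^+ 2 + 2 * (b - c) ^+ 2.
      by ring.
    move: bc ab2 sq; lra.
rewrite (RintD mu bt b2) Rint_cst (RintZ mu 2 (bavg _ bG)).
have -> : \int[mu]_x avg M N (fun n => (A (iter n S (diag x)) - c) ^+ 2) =
    avg M N (fun n => \int[mu]_x (A (iter n S (diag x)) - c) ^+ 2).
  rewrite /avg RintZ; last by apply: bdd_meas_sum => n; exact: bdd_iter bG.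
  by rewrite Rint_sum// => n; exact: bdd_iter bG.
have h2 : C * \int[nu]_y (A y - c) ^+ 2 <= C * (e / (8 * C)) by rewrite ler_wpM2l// ltW.
have h3 : C * (e / (8 * C)) = e / 8 by field; rewrite gt_eqF.
have t1 : t <= 1 by rewrite ge_min lexx.
have te : t <= e / 4 by rewrite ge_min lexx orbT.
have h5 : t ^+ 2 <= t * 1 by rewrite expr2 ler_wpM2l ?(ltW t0).
rewrite -/(A _) in h1; move: h1 h2 h3 h5 te; lra.
Qed.

End Joint.

End Domination.

(** * The equivalence *)

Section L2.
Context {R : realType} {d : measure_display} {X : measurableType d}.
Variable mu : probability X R.

Lemma Lnorm2E (h : X -> R) : bdd_meas h ->
  (Lnorm mu 2%:E (fun x => (h x)%:E) = (Num.sqrt (\int[mu]_x h x ^+ 2))%:E)%E.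
Proof.
move=> bh; rewrite unlock /=.
rewrite (_ : (\int[mu]_x _)%E = (\int[mu]_x h x ^+ 2)%:E); last first.
  rewrite EFin_Rint; last exact: bdd_measX.
  by apply: eq_integral => x _; rewrite /= powR_mulrn// real_normK ?num_real.
rewrite poweR_EFin; congr EFin; rewrite powR12_sqrt//.
by apply: ge0_Rint => x; exact: sqr_ge0.
Qed.

Lemma Lnorm2_lt (h : X -> R) (e : R) : bdd_meas h -> 0 < e ->
  (Lnorm mu 2%:E (fun x => (h x)%:E) < e%:E)%E = (\int[mu]_x h x ^+ 2 < e ^+ 2).
Proof.
move=> bh e0; rewrite Lnorm2E// lte_fin.
by rewrite -[X in _ < X](ger0_norm (ltW e0)) -sqrtr_sqr ltr_sqrt// exprn_gt0.
Qed.

(** The variance of |h| is non-negative; this is the passage from L2 to L1 in (i) => (ii). *)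
Lemma Rint_norm_sqr (h : X -> R) : bdd_meas h ->
  (\int[mu]_x `|h x|) ^+ 2 <= \int[mu]_x h x ^+ 2.
Proof.
move=> bh; set m := \int[mu]_x `|h x|.
have bn := bdd_meas_norm bh; have b2 := bdd_measX 2 bh.
have : 0 <= \int[mu]_x (`|h x| - m) ^+ 2 by apply: ge0_Rint => x; exact: sqr_ge0.
have bm : bdd_meas (fun _ : X => m ^+ 2) by exact: bdd_meas_cst.
rewrite (_ : (fun x => _) = fun x => h x ^+ 2 + ((- 2 * m) * `|h x| + m ^+ 2)).
  rewrite (RintD mu b2 (bdd_measD (bdd_measZ _ bn) bm)).
  rewrite (RintD mu (bdd_measZ _ bn) bm) (RintZ mu _ bn) Rint_cst -/m; lra.
by apply/funext => x; rewrite -(real_normK (num_real (h x))); ring.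
Qed.

End L2.

(** * The limit superior in epsilon form *)

Section Limsup.
Context {R : realType}.

Lemma limsup_diff_le (a : nat -> nat -> R) (c : R) :
  (limsup_diff (fun M N => (a M N)%:E) <= c%:E)%E <->
  forall e, 0 < e -> exists L : nat, forall M N : nat,
    (M < N)%N -> (L <= N - M)%N -> a M N <= c + e.
Proof.
split=> [h e e0|h].
  have : (limsup_diff (fun M N => (a M N)%:E) < (c + e)%:E)%E.
    by rewrite (le_lt_trans h)// lte_fin ltrDl.
  move=> /ereal_inf_lt[_ [L _ <-]] hL; exists L => M N MN LMN.
  rewrite -lee_fin; apply: le_trans (ltW hL); apply: ereal_sup_ubound.
  by exists (M, N).
apply/lee_addgt0Pr => e e0; have [L hL] := h _ e0.
apply: le_trans (ereal_inf_lbound _) _; first by exists L.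
apply: ub_ereal_sup => _ [[M N] [MN LMN] <-] /=.
by rewrite -EFinD lee_fin; exact: hL.
Qed.

End Limsup.

Section Diag.
Context {R : realType} {d : measure_display} {X : measurableType d} {k : nat}.
Variable mu : probability X R.
Variable T : 'I_k -> X -> X.
Hypothesis mT : forall i, measurable_fun setT (T i).

(** The intersection is the preimage of the rectangle under x |-> S^n(x,...,x), so the averages in
    (iv) are averages along orbits of the diagonal. *)
Lemma avg_measure_bigcap (A : 'I_k -> set X) M N : (forall i, measurable (A i)) ->
  (((N - M)%:R^-1)%:E *
     \sum_(M <= n < N) mu (\bigcap_(i : 'I_k) (iter n (T i) @^-1` A i)))%E =
  (avg M N (fun n => \int[mu]_x \1_(rect A) (iter n (tuple_map T) (diag x))))%:E :> \bar R.
Proof.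
move=> mA; rewrite /avg EFinM -sumEFin; congr (_ * _)%E.
apply: eq_bigr => n _.
have mD := measurable_iter_diag mT n.
have mB : measurable ((fun x => iter n (tuple_map T) (diag x)) @^-1` rect A).
  by rewrite -[X in measurable X]setTI; exact: (mD measurableT _ (measurable_rect mA)).
transitivity (mu ((fun x => iter n (tuple_map T) (diag x)) @^-1` rect A)).
  congr (mu _); apply/seteqP; split=> x /= h i; have := h i; rewrite tnth_iter_diag.
    exact.
  by [].
by rewrite -[LHS]fineK ?fin_num_measure// -Rint_indic.
Qed.

End Diag.

Theorem theorem2p1 (R : realType) (d : measure_display) (X : measurableType d)
  (dist : X -> X -> R) (hX : compact_metric_borel dist)
  (mu : probability X R) (k : nat)
  (T : 'I_k -> X -> X) (mu_ : 'I_k -> probability X R)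
  (hT : forall i, measurable_fun setT (T i))
  (hinv : forall i, invariant_measure (T i) (mu_ i))
  (hequiv : forall i, equiv_measure mu (mu_ i)) :
  [<-> 
   (* (i) uniform joint ergodicity *)
   (forall f : 'I_k -> X -> R, (forall i, bdd_meas (f i)) ->
      L2cvg_diff mu
        (fun M N x => (N - M)%:R^-1 *
           \sum_(M <= n < N) \prod_(i < k) f i (iter n (T i) x))
        (\prod_(i < k) \int[mu_ i]_x f i x));
   (* (ii) *)
   (forall (f0 : X -> R) (f : 'I_k -> X -> R), bdd_meas f0 ->
      (forall i, bdd_meas (f i)) ->
      cvg_diff
        (fun M N => (N - M)%:R^-1 *
           \sum_(M <= n < N)
              \int[mu]_x (f0 x * \prod_(i < k) f i (iter n (T i) x)))
        ((\int[mu]_x f0 x) * \prod_(i < k) \int[mu_ i]_x f i x));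
   (* (iii) *)
   (product_ergodic T (fun i => mu_ i) /\
    forall f : 'I_k -> X -> R, (forall i, bdd_meas (f i)) ->
      cvg_diff
        (fun M N => (N - M)%:R^-1 *
           \sum_(M <= n < N) \int[mu]_x (\prod_(i < k) f i (iter n (T i) x)))
        (\prod_(i < k) \int[mu_ i]_x f i x));
   (* (iv) *)
   (product_ergodic T (fun i => mu_ i) /\
    exists C : R, 0 < C /\
      forall A : 'I_k -> set X, (forall i, measurable (A i)) ->
        (limsup_diff
          (fun M N => ((N - M)%:R^-1)%:E *
             \sum_(M <= n < N) mu (\bigcap_(i : 'I_k) (iter n (T i) @^-1` A i)))
         <= (C * \prod_(i < k) fine (mu_ i (A i)))%:E)%E)
  ].
Proof.
tfae.
- move=> strong f0 f b0 bf e e0.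
  have [M M0 f0M] := bdd_meas_bound b0.
  (* Integration against f0 costs a factor M. *)
  have [L hL] := strong f bf (e / M) (divr_gt0 e0 M0).
  exists L => M' N MN LMN; have {hL} := hL M' N MN LMN.
  set c := \prod_(i < k) _.
  pose P n x := \prod_(i < k) f i (iter n (T i) x).
  have bP n : bdd_meas (P n).
    apply: bdd_meas_prod => i; exact: bdd_meas_comp (bf i) (measurable_iter n (hT i)).
  have ba : bdd_meas (fun x => avg M' N (P ^~ x)).
    by apply: bdd_measZ; exact: bdd_meas_sum.
  have bg : bdd_meas (fun x => avg M' N (P ^~ x) - c).
    by apply: bdd_measB => //; exact: bdd_meas_cst.
  rewrite (Lnorm2_lt mu bg (divr_gt0 e0 M0)) => h.
  have -> : (N - M')%:R^-1 * \sum_(M' <= n < N) \int[mu]_x (f0 x * P n x) =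
      \int[mu]_x (f0 x * avg M' N (P ^~ x)).
    rewrite -Rint_sum => [|n]; last exact: bdd_measM.
    rewrite -RintZ; last by apply: bdd_meas_sum => n; exact: bdd_measM.
    by apply: eq_Rintegral => x _; rewrite -mulr_sumr mulrCA.
  rewrite [_ * c]mulrC -RintZ// -RintB; [|exact: bdd_measM|exact: bdd_measZ].
  apply: le_lt_trans (norm_Rint _ _) _.
    by apply: bdd_measB; [exact: bdd_measM|exact: bdd_measZ].
  have h2 : \int[mu]_x `|avg M' N (P ^~ x) - c| < e / M.
    rewrite -(ltr_pXn2r (n := 2))// ?nnegrE.
    + by apply: le_lt_trans h; exact: Rint_norm_sqr.
    + exact: ge0_Rint.
    + by rewrite ltW// divr_gt0.
  apply: (@le_lt_trans _ _ (M * \int[mu]_x `|avg M' N (P ^~ x) - c|)).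
    rewrite -RintZ; last exact: bdd_meas_norm.
    apply: le_Rint.
    + by apply/bdd_meas_norm/bdd_measB; [exact: bdd_measM|exact: bdd_measZ].
    + exact/bdd_measZ/bdd_meas_norm.
    + by move=> x; rewrite [c * _]mulrC -mulrBr normrM ler_wpM2r.
  by rewrite mulrC -ltr_pdivlMr.
- move=> weak; split.
    move=> nu hnu B mB SB.
    (* The given [nu] is a bare measure; by uniqueness it agrees with a probability P, to which
       [weak_ergodic] applies. *)
    have [P hP] := product_measure_exists mu_.
    rewrite (product_measure_uniq hP hnu mB).
    exact: (weak_ergodic hP hT hinv weak mB SB).
  move=> f bf; have := weak (fun=> 1) f (bdd_meas_cst _) bf.
  rewrite Rint_cst mul1r; congr (cvg_diff _ _).
  apply/funext => M; apply/funext => N; congr (_ * _); apply: eq_bigr => n _.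
  by apply: eq_Rintegral => x _; rewrite mul1r.
(* For indicators (iii)(b) is convergence to the product of the measures, so C = 1 will do. *)
- move=> [erg cvg]; split=> //; exists 1; split=> // A mA.
  rewrite mul1r.
  under [X in limsup_diff X]eq_fun do under eq_fun do rewrite (avg_measure_bigcap mu hT _ _ mA).
  apply/limsup_diff_le => e e0.
  have [L hL] := cvg (fun i => \1_(A i)) (fun i => bdd_meas_indic (mA i)) e e0.
  exists L => M N MN LMN; have := hL M N MN LMN.
  rewrite (_ : _ * _ = avg M N (fun n =>
     \int[mu]_x \1_(rect A) (iter n (tuple_map T) (diag x)))); last first.
    congr (_ * _); apply: eq_bigr => n _; apply: eq_Rintegral => x _.
    by rewrite indic_rect; apply: eq_bigr => i _; rewrite tnth_iter_diag.
  rewrite (eq_bigr (fun i => fine (mu_ i (A i)))); last first.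
    by move=> i _; rewrite Rint_indic.
  by rewrite ltr_norml => /andP[_]; lra.
- move=> [erg [C [C0 hC]]] f bf e e0.
  have [P hP] := product_measure_exists mu_.
  have dom A : (forall i, measurable (A i)) -> dominated mu P T C (\1_(rect A)).
    move=> mA; have := hC A mA.
    under [X in limsup_diff X]eq_fun do
      under eq_fun do rewrite (avg_measure_bigcap mu hT _ _ mA).
    move=> /limsup_diff_le h e1 e10; have [L hL] := h e1 e10.
    exists L => M N MN LMN; rewrite Rint_indic; last exact: measurable_rect.
    by rewrite [X in fine X]hP//; exact: hL.
  (* The norm is below e when the square integrates to less than e^2; halving turns the weak
     inequality obtained into a strict one. *)
  have e20 : 0 < e ^+ 2 / 2 by rewrite divr_gt0// exprn_gt0.
  have [L hL] := joint_mean_convergence hP hT hinv (erg P hP) C0 dom bf e20.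
  exists L => M N MN LMN; have {hL} h := hL M N MN LMN.
  have bg : bdd_meas (fun x => (N - M)%:R^-1 *
      \sum_(M <= n < N) \prod_(i < k) f i (iter n (T i) x) -
      \prod_(i < k) \int[mu_ i]_x f i x).
    apply: bdd_measB; last exact: bdd_meas_cst.
    apply: bdd_measZ; apply: bdd_meas_sum => n; apply: bdd_meas_prod => i.
    exact: bdd_meas_comp (bf i) (measurable_iter n (hT i)).
  rewrite (Lnorm2_lt mu bg e0).
  apply: (@le_lt_trans _ _ (e ^+ 2 / 2)).
    apply: le_trans h; rewrite le_eqVlt; apply/orP; left; apply/eqP.
    apply: eq_Rintegral => x _; congr ((_ * _ - _) ^+ 2).
    apply: eq_bigr => n _; by apply: eq_bigr => i _; rewrite tnth_iter_diag.
  by rewrite ltr_pdivrMr// ltr_pMr ?exprn_gt0// ltr1n.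
Qed.
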